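(* For every prime $p$, every cyclic $p$-group is separable with respect to the class $\mathcal{K}_A$ of abelian groups.
   Context: All groups are finite. For a subset $X$ of a group $G$ write $\underline{X}=\sum_{x\in X}x\in\mathbb{Z}G$ and $X^{-1}=\{x^{-1}:x\in X\}$. A subring $\mathcal{A}\subseteq\mathbb{Z}G$ is an $S$-ring (Schur ring) over $G$ if there is a partition $\mathcal{S}=\mathcal{S}(\mathcal{A})$ of $G$ such that (1) $\{e\}\in\mathcal{S}$; (2) $X\in\mathcal{S}$ implies $X^{-1}\in\mathcal{S}$; (3) $\mathcal{A}=\mathrm{Span}_{\mathbb{Z}}\{\underline{X}:X\in\mathcal{S}\}$. The elements of $\mathcal{S}(\mathcal{A})$ are called the basic sets of $\mathcal{A}$. For $X,Y,Z\in\mathcal{S}(\mathcal{A})$ let $c^Z_{X,Y}$ be the structure constants, defined by $\underline{X}\,\underline{Y}=\sum_{Z\in\mathcal{S}(\mathcal{A})}c^Z_{X,Y}\underline{Z}$. For $X\subseteq G$ put $R(X)=\{(g,xg):x\in X,\ g\in G\}$. Let $\mathcal{A}$ and $\mathcal{A}'$ be $S$-rings over groups $G$ and $G'$ respectively. An algebraic isomorphism from $\mathcal{A}$ to $\mathcal{A}'$ is a bijection $\varphi:\mathcal{S}(\mathcal{A})\to\mathcal{S}(\mathcal{A}')$ with $c^Z_{X,Y}=c^{Z^\varphi}_{X^\varphi,Y^\varphi}$ for all $X,Y,Z\in\mathcal{S}(\mathcal{A})$. A (combinatorial) isomorphism from $\mathcal{A}$ to $\mathcal{A}'$ is a bijection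 $f:G\to G'$ such that $\{R(X)^f:X\in\mathcal{S}(\mathcal{A})\}=\{R(X'):X'\in\mathcal{S}(\mathcal{A}')\}$, where $R(X)^f=\{(g^f,h^f):(g,h)\in R(X)\}$. Every such $f$ induces an algebraic isomorphism $\varphi_f$, given by $R(X)^f=R(X^{\varphi_f})$; an algebraic isomorphism $\varphi$ is said to be induced by $f$ if $\varphi=\varphi_f$. Let $\mathcal{K}$ be a class of groups. An $S$-ring $\mathcal{A}$ is separable with respect to $\mathcal{K}$ if every algebraic isomorphism from $\mathcal{A}$ to an $S$-ring over a group from $\mathcal{K}$ is induced by a combinatorial isomorphism. A finite group $G$ is separable with respect to $\mathcal{K}$ if every $S$-ring over $G$ is separable with respect to $\mathcal{K}$. $\mathcal{K}_A$ denotes the class of abelian groups. *)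

(* Defs.v *)
From HB Require Import structures.
From mathcomp Require Import all_boot all_order all_algebra all_fingroup all_solvable.

Set Implicit Arguments.
Unset Strict Implicit.
Unset Printing Implicit Defensive.

Import GRing.Theory.
Local Open Scope ring_scope.

(* A finite group is a finGroupType, i.e. the group is the whole type gT.
   Elements of the integral group ring ZG are the families of their
   coefficients; the product is convolution, not the pointwise product that
   {ffun gT -> int} could also carry, hence the alias. *)
Definition group_ring (gT : finGroupType) : Type := {ffun gT -> int}.

HB.instance Definition _ (gT : finGroupType) :=
  GRing.Zmodule.copy (group_ring gT) {ffun gT -> int}.

Section GroupRing.
Variable gT : finGroupType.
Implicit Types a b c : group_ring gT.

Definition gr_one : group_ring gT := [ffun g => (g == 1%g)%:R].

Definition gr_mul a b : group_ring gT :=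
  [ffun g => \sum_(h : gT) a h * b (h^-1 * g)%g].

Fact gr_mulA : associative gr_mul.
Proof.
move=> a b c; apply/ffunP => g; rewrite !ffunE.
under [RHS]eq_bigr => h _ do rewrite ffunE mulr_suml.
rewrite exchange_big /=; apply: eq_bigr => k _.
rewrite ffunE mulr_sumr (reindex_inj (mulgI k^-1%g)) /=; apply: eq_bigr => h _.
by rewrite mulrA invMg invgK -mulgA mulKVg.
Qed.

Fact gr_mul1 : left_id gr_one gr_mul.
Proof.
move=> a; apply/ffunP => g; rewrite ffunE (bigD1 1%g) //= big1 => [|h hN1].
  by rewrite ffunE eqxx mul1r invg1 mul1g addr0.
by rewrite ffunE (negbTE hN1) mul0r.
Qed.

Fact gr_mulr1 : right_id gr_one gr_mul.
Proof.
move=> a; apply/ffunP => g; rewrite ffunE (bigD1 g) //= big1 => [|h hNg].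
  by rewrite ffunE mulVg eqxx mulr1 addr0.
by rewrite ffunE -eq_mulVg1 (negbTE hNg) mulr0.
Qed.

Fact gr_mulDl : left_distributive gr_mul +%R.
Proof.
move=> a b c; apply/ffunP => g; rewrite !ffunE -big_split /=.
by apply: eq_bigr => h _; rewrite ffunE mulrDl.
Qed.

Fact gr_mulDr : right_distributive gr_mul +%R.
Proof.
move=> a b c; apply/ffunP => g; rewrite !ffunE -big_split /=.
by apply: eq_bigr => h _; rewrite ffunE mulrDr.
Qed.

Fact gr_one_neq0 : gr_one != 0.
Proof. by apply/eqP => /ffunP/(_ 1%g); rewrite !ffunE eqxx. Qed.

End GroupRing.

HB.instance Definition _ (gT : finGroupType) :=
  GRing.Zmodule_isNzRing.Build (group_ring gT) (@gr_mulA gT) (@gr_mul1 gT)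
    (@gr_mulr1 gT) (@gr_mulDl gT) (@gr_mulDr gT) (@gr_one_neq0 gT).

(* The sum of the elements of X. *)
Definition gsum (gT : finGroupType) (X : {set gT}) : group_ring gT :=
  [ffun g => (g \in X)%:R].

(* The partition is a field of the structure, but it is determined by the
   carrier. *)
Record Sring (gT : finGroupType) := MkSring {
  Scarrier : {pred group_ring gT};
  basic_sets : {set {set gT}};
  Scarrier_subring : subring_closed Scarrier;
  basic_sets_partition : partition basic_sets [set: gT];
  basic_sets_one : [set 1%g] \in basic_sets;
  basic_sets_inv :
    forall X : {set gT}, X \in basic_sets -> (X^-1)%g \in basic_sets;
  Scarrier_span : forall a : group_ring gT,
    a \in Scarrier <->
    exists c : {set gT} -> int, a = \sum_(X in basic_sets) gsum X *~ c X
}.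

Definition basic_set (gT : finGroupType) (A : Sring gT) : Type :=
  {X : {set gT} | X \in basic_sets A}.

Section StructConst.
Variables (gT : finGroupType) (A : Sring gT).
Implicit Types X Y Z : basic_set A.

Fact gsum_in_Sring X : gsum (val X) \in Scarrier A.
Proof.
apply/Scarrier_span; exists (fun W => (W == val X)%:Z).
rewrite (bigD1 (val X)) ?(valP X) //= eqxx big1 ?addr0 // => W /andP[_ /negbTE->].
by rewrite mulr0z.
Qed.

Fact struct_const_ex X Y : exists c : {ffun {set gT} -> int},
  gsum (val X) * gsum (val Y) == \sum_(W in basic_sets A) gsum W *~ c W.
Proof.
have [_ _ mulA] := Scarrier_subring A.
have /Scarrier_span[c XYc] := mulA _ _ (gsum_in_Sring X) (gsum_in_Sring Y).
by exists (finfun c); rewrite XYc; apply/eqP/eq_bigr => W _; rewrite ffunE.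
Qed.

(* struct_const Z X Y is c^Z_{X,Y}; by struct_constP below, the choice of the
   family c is irrelevant on the basic sets of A. *)
Definition struct_const Z X Y : int := xchoose (struct_const_ex X Y) (val Z).

Fact mulrz_ffunE (a : group_ring gT) (n : int) g : (a *~ n) g = a g *~ n.
Proof. by case: n => n; rewrite ?NegzE ?mulrNz ?ffunE -!pmulrn ffunMnE. Qed.

Fact gsum_span_coef (c : {set gT} -> int) Z z :
  z \in val Z -> (\sum_(W in basic_sets A) gsum W *~ c W) z = c (val Z).
Proof.
move=> zZ; have /and3P[_ /trivIsetP tiA _] := basic_sets_partition A.
rewrite sum_ffunE (bigD1 (val Z)) ?(valP Z) //= big1.
  by rewrite addr0 mulrz_ffunE ffunE zZ intz.
move=> W /andP[WA WZ]; rewrite mulrz_ffunE ffunE.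
have /pred0P/(_ z)/= := tiA _ _ WA (valP Z) WZ.
by rewrite zZ andbT => ->; rewrite mul0rz.
Qed.

Fact struct_constP X Y (c : {set gT} -> int) :
  gsum (val X) * gsum (val Y) = \sum_(W in basic_sets A) gsum W *~ c W <->
  forall Z, struct_const Z X Y = c (val Z).
Proof.
have /eqP XYd := xchooseP (struct_const_ex X Y); split=> [XYc Z | cE].
  have [z zZ] : exists z, z \in val Z.
    apply/set0Pn; have /and3P[_ _] := basic_sets_partition A.
    by apply: contraNneq => <-; apply: valP.
  by rewrite /struct_const -(gsum_span_coef _ zZ) -XYd XYc (gsum_span_coef _ zZ).
rewrite XYd; apply: eq_bigr => W WA.
by congr (_ *~ _); apply: (cE (exist _ W WA)).
Qed.

End StructConst.

Definition algebraic_iso (gT gT' : finGroupType) (A : Sring gT)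
    (A' : Sring gT') (phi : basic_set A -> basic_set A') : Prop :=
  bijective phi /\
  forall X Y Z : basic_set A,
    struct_const Z X Y = struct_const (phi Z) (phi X) (phi Y).

Definition arcs (gT : finGroupType) (X : {set gT}) : {set gT * gT} :=
  [set (g, (x * g)%g) | x in X, g in [set: gT]].

Definition rel_image (T T' : finType) (f : T -> T') (E : {set T * T}) :
    {set T' * T'} :=
  [set (f e.1, f e.2) | e in E].

Definition combinatorial_iso (gT gT' : finGroupType) (A : Sring gT)
    (A' : Sring gT') (f : gT -> gT') : Prop :=
  bijective f /\
  [set rel_image f (arcs X) | X in basic_sets A]
    = [set arcs X' | X' in basic_sets A'].

Definition induced_by (gT gT' : finGroupType) (A : Sring gT)
    (A' : Sring gT') (phi : basic_set A -> basic_set A') (f : gT -> gT') :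
    Prop :=
  forall X : basic_set A, rel_image f (arcs (val X)) = arcs (val (phi X)).

Definition separable_Sring (K : finGroupType -> Prop) (gT : finGroupType)
    (A : Sring gT) : Prop :=
  forall (gT' : finGroupType) (A' : Sring gT')
    (phi : basic_set A -> basic_set A'),
  K gT' -> algebraic_iso phi ->
  exists f : gT -> gT', combinatorial_iso A A' f /\ induced_by phi f.

Definition separable_group (K : finGroupType -> Prop) (gT : finGroupType) :
    Prop :=
  forall A : Sring gT, separable_Sring K A.

Definition abelian_group (gT : finGroupType) : Prop := abelian [set: gT].

(* Main.v *)
Require Import Defs.
From mathcomp Require Import all_boot all_order all_algebra all_fingroup all_solvable.
From mathcomp Require Import zify.

Set Implicit Arguments.
Unset Strict Implicit.
Unset Printing Implicit Defensive.

Import GRing.Theory Num.Theory.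
Local Open Scope ring_scope.

(* An algebraic isomorphism is handled as the relation e between G and G' that
   links the elements of each basic set to those of its image; e is compatible
   with the product of the group rings.  Since (sum of X)^q is congruent to the
   sum of the q-th powers modulo p for q a power of the prime p, e respects
   powers with exponents prime to |G| (Schur's multipliers), and numbers of q-th
   roots modulo p.

   For x generating an A-subgroup H of G, let X be its basic set and D the
   radical of X.  If <x^p> is not an A-subgroup then X = H \ D.  If it is, X
   consists of generators of H, hence modulo D it is an orbit of a group of
   multipliers, and for every x' linked to x the map x |-> x' induces an
   isomorphism from H / D to its counterpart in G' which respects e; that x' has
   full order modulo D' comes from counting q-th roots.

   By induction on |H|, every isomorphism H / L -> H' / L' respecting e lifts to
   a map H -> H' respecting e: on the cosets of <x^p> (or of D) it is glued from
   translates of a map given by induction. *)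

(** The relation [e] sees elements only up to basic sets, and G' is merely abelian, so a linked x'
    need not have the order of x: this is why orders must be recovered by counting roots modulo p.

    The map f sought is not a homomorphism. Since arcs are the pairs (g, x * g), being induced only
    means [e (g * h^-1) (f g * (f h)^-1)], and this freedom allows maps to be chosen coset by coset.
    A quotient g * h^-1 across two cosets lies in a basic set that is a union of L-cosets, so there
    only f modulo L matters. Hence the pieces must have a prescribed reduction modulo L, and the
    induction has to lift a given isomorphism of quotients instead of producing just some f.

    The prime 2 is the main obstacle: a multiplier congruent to 1 modulo 2 may be 3 modulo 4 and
    move x. Counting roots with modulus 4 then loses one factor 2 of the order, and the last power
    has to be recovered by separate arguments. *)

Lemma abelian_setT_mulC (gT : finGroupType) (cG : abelian [set: gT]) (x y : gT) :
  (x * y = y * x)%g.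
Proof. by apply: (centsP cG); rewrite inE. Qed.

(** * Convolution in the group ring and p-th powers modulo p *)

Section GroupRingFacts.
Variable gT : finGroupType.
Implicit Types (a b : group_ring gT) (X Y : {set gT}) (x y g h : gT).

Lemma gr_mulE a b g : (a * b) g = \sum_(h : gT) a h * b (h^-1 * g)%g.
Proof. by rewrite ffunE. Qed.

Lemma gr_oneE g : (1 : group_ring gT) g = (g == 1%g)%:R.
Proof. by rewrite ffunE. Qed.

Lemma gsum_mulE X Y g :
  (gsum X * gsum Y) g = #|[set x in X | (x^-1 * g)%g \in Y]|%:R.
Proof.
rewrite gr_mulE -sum1_card natr_sum [RHS]big_mkcond /=.
by apply: eq_bigr => h _; rewrite !ffunE inE; do 2!case: (_ \in _); rewrite ?mulr0 ?mul0r ?mulr1.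
Qed.

Lemma gsum1M x y : gsum [set x] * gsum [set y] = gsum [set (x * y)%g].
Proof.
apply/ffunP => g; rewrite gsum_mulE ffunE inE; congr (_%:R).
case: eqP => [->|gN].
  rewrite (_ : [set _ in _ | _] = [set x]) ?cards1 //.
  by apply/setP => h; rewrite !inE; case: eqP => //= ->; rewrite mulKg eqxx.
rewrite (_ : [set _ in _ | _] = set0) ?cards0 //.
apply/setP => h; rewrite !inE; case: eqP => //= ->.
by apply/negbTE/eqP => xgy; apply: gN; rewrite -xgy mulKVg.
Qed.

Lemma gsum1X x n : gsum [set x] ^+ n = gsum [set (x ^+ n)%g].
Proof.
elim: n => [|n IHn]; last by rewrite exprS IHn gsum1M -expgS.
by apply/ffunP => g; rewrite expr0 expg0 gr_oneE ffunE inE.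
Qed.

Lemma gsum_sum1 X : gsum X = \sum_(x in X) gsum [set x].
Proof.
apply/ffunP => g; rewrite ffunE sum_ffunE; case: (boolP (g \in X)) => gX.
  rewrite (bigD1 g) //= big1 ?addr0 ?ffunE ?inE ?eqxx // => h /andP[_ hg].
  by rewrite ffunE inE eq_sym (negbTE hg).
rewrite big1 // => h hX; rewrite ffunE inE; case: eqP => // gh.
by rewrite gh hX in gX.
Qed.

Lemma gr_mulC (cG : abelian [set: gT]) a b : a * b = b * a.
Proof.
apply/ffunP => g; rewrite !gr_mulE.
rewrite (reindex_inj (inj_comp (mulgI g) invg_inj)) /=; apply: eq_bigr => h _.
rewrite mulrC; congr (b _ * a _).
  by rewrite invMg invgK mulgKV.
exact: abelian_setT_mulC.
Qed.

End GroupRingFacts.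

Section Frobenius.
Variables (R : nzRingType) (p : nat).
Hypotheses (p_pr : prime p) (mulC : forall x y : R, x * y = y * x).

Lemma exprD_prime (x y : R) : exists z, (x + y) ^+ p = x ^+ p + y ^+ p + z *+ p.
Proof.
have [q q1] : exists q, q.+1 = p by exists p.-1; rewrite prednK ?prime_gt0.
rewrite exprDn_comm; last exact: mulC.
rewrite -q1 big_ord_recl big_ord_recr /= subn0 expr0 mulr1 bin0 mulr1n.
rewrite /bump /= add1n subnn expr0 mul1r binn mulr1n.
exists (\sum_(i < q) (x ^+ (q - i) * y ^+ i.+1) *+ ('C(q.+1, i.+1) %/ q.+1)).
rewrite addrA [LHS]addrAC; congr (_ + _).
rewrite -sumrMnl; apply: eq_bigr => i _; rewrite -mulrnA add1n subSS.
by rewrite divnK // q1 prime_dvd_bin //; have := ltn_ord i; lia.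
Qed.

Lemma exprD_mulrn_prime (x y : R) :
  exists z, (x + y *+ p) ^+ p = x ^+ p + z *+ p.
Proof.
have [z ->] := exprD_prime x (y *+ p).
exists ((y *+ p) ^+ p.-1 * y + z).
rewrite -addrA; congr (_ + _); rewrite mulrnDl; congr (_ + _).
by rewrite -{2}(prednK (prime_gt0 p_pr)) exprSr mulrnAr.
Qed.

Lemma expr_sum_prime (I : Type) (r : seq I) (P : pred I) (F : I -> R) :
  exists z, (\sum_(i <- r | P i) F i) ^+ p = \sum_(i <- r | P i) F i ^+ p + z *+ p.
Proof.
elim: r => [|i r [z IHr]].
  by exists 0; rewrite !big_nil mul0rn addr0 expr0n gtn_eqF ?prime_gt0.
rewrite !big_cons; case: (P i); last by exists z.
have [t ->] := exprD_prime (F i) (\sum_(j <- r | P j) F j).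
by exists (z + t); rewrite IHr mulrnDl !addrA.
Qed.

Lemma expr_sum_primeX (I : Type) (r : seq I) (P : pred I) (F : I -> R) j :
  exists z, (\sum_(i <- r | P i) F i) ^+ (p ^ j)
            = \sum_(i <- r | P i) F i ^+ (p ^ j) + z *+ p.
Proof.
elim: j => [|j [z IHj]]; first by exists 0; rewrite expn0 mul0rn addr0.
rewrite expnSr exprM IHj.
have [t ->] := exprD_mulrn_prime (\sum_(i <- r | P i) F i ^+ (p ^ j)) z.
have [u ->] := expr_sum_prime r P (fun i => F i ^+ (p ^ j)).
exists (u + t); rewrite mulrnDl !addrA; congr (_ + _ + _).
by apply: eq_bigr => i _; rewrite exprM.
Qed.

End Frobenius.

Lemma gsum_expn_prime (gT : finGroupType) (cG : abelian [set: gT]) p j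
    (X : {set gT}) (g : gT) : prime p ->
  exists z : int,
    (gsum X ^+ (p ^ j)) g = #|[set x in X | (x ^+ (p ^ j))%g == g]|%:R + z *+ p.
Proof.
move=> p_pr; rewrite gsum_sum1.
have [z ->] := expr_sum_primeX p_pr (gr_mulC cG) (index_enum gT) (mem X)
  (fun x => gsum [set x]) j.
exists (z g); rewrite ffunE ffunMnE sum_ffunE; congr (_ + _).
rewrite -sum1_card natr_sum big_mkcond [RHS]big_mkcond /=; apply: eq_bigr => x _.
by rewrite gsum1X ffunE !inE eq_sym; case: (x \in X); case: (_ == _).
Qed.

(** * Relations standing for algebraic isomorphisms *)

Section SchurRelation.
Variables (gT gT' : finGroupType) (e : gT -> gT' -> bool).

(** Since every x' in the image of a basic set is linked to every x in it, this forces [a] and [a']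
    to be constant on basic sets and to correspond under the linear extension of the algebraic
    isomorphism. *)
Definition schur_compat (a : group_ring gT) (a' : group_ring gT') :=
  forall x x', e x x' -> a x = a' x'.

(* e stands for an algebraic isomorphism phi between S-rings over gT and gT':
   e x x' holds iff x' lies in the image under phi of the basic set of x. *)
Record schur_rel : Prop := SchurRel {
  srel_total : forall x, exists x', e x x';
  srel_surj : forall x', exists x, e x x';
  srel_difun : forall x y x' y', e x x' -> e y x' -> e y y' -> e x y';
  srel_one : forall x x', e x x' -> (x == 1%g) = (x' == 1%g);
  srel_mul : forall a b a' b', schur_compat a a' -> schur_compat b b' ->
    schur_compat (a * b) (a' * b')
}.

Definition schur_csets (U : {set gT}) (U' : {set gT'}) :=
  forall x x', e x x' -> (x \in U) = (x' \in U').

(** [schur_im] is the image of the basic set of x, [schur_blk] that basic set itself, and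
    [schur_aset] tells whether U is a union of basic sets. Defining them from [e] alone lets the
    same results be applied to quotients. *)
Definition schur_im (x : gT) : {set gT'} := [set x' | e x x'].
Definition schur_blk (x : gT) : {set gT} := [set y | [exists x', e x x' && e y x']].
Definition schur_aset (U : {set gT}) : bool := [forall x in U, schur_blk x \subset U].

End SchurRelation.

Section Counting.
Variables (gT gT' : finGroupType) (e : gT -> gT' -> bool).
Hypotheses (cG : abelian [set: gT]) (cG' : abelian [set: gT']).
Hypothesis se : schur_rel e.

Local Notation compat := (schur_compat e).
Local Notation csets := (schur_csets e).
Local Notation blk := (schur_blk e).
Local Notation im := (schur_im e).
Local Notation aset := (schur_aset e).

Lemma compat1 : compat 1 1.
Proof. by move=> x x' exx'; rewrite !gr_oneE (srel_one se exx'). Qed.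

Lemma compatX a a' n : compat a a' -> compat (a ^+ n) (a' ^+ n).
Proof.
move=> aa'; elim: n => [|n IHn]; first exact: compat1.
by rewrite !exprS; apply: srel_mul.
Qed.

Lemma csets_gsum U U' : csets U U' -> compat (gsum U) (gsum U').
Proof. by move=> UU' x x' exx'; rewrite !ffunE (UU' _ _ exx'). Qed.

Lemma csets_mul_card U U' V V' g g' : csets U U' -> csets V V' -> e g g' ->
  #|[set u in U | (u^-1 * g)%g \in V]| = #|[set u in U' | (u^-1 * g')%g \in V']|.
Proof.
move=> UU' VV' /(srel_mul se (csets_gsum UU') (csets_gsum VV')).
by rewrite !gsum_mulE => /eqP; rewrite eqr_nat => /eqP.
Qed.

Lemma csets_pow_card p j U U' g g' : prime p -> csets U U' -> e g g' ->
  #|[set x in U | (x ^+ (p ^ j))%g == g]|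
  = #|[set x in U' | (x ^+ (p ^ j))%g == g']| %[mod p].
Proof.
move=> p_pr UU' /(compatX (p ^ j) (csets_gsum UU')).
have [z ->] := gsum_expn_prime cG j U g p_pr.
have [z' ->] := gsum_expn_prime cG' j U' g' p_pr.
set m := #|_|; set m' := #|_| => mm'.
apply/eqP; rewrite -eqz_nat -!modz_nat; apply/eqP.
have shift (n : nat) (w : int) : (n%:R + w *+ p : int) = (w * p%:Z + n%:Z)%R.
  by rewrite -[w *+ p]mulr_natr !natz addrC.
rewrite -(modzMDl z m p) -(modzMDl z' m' p); congr (_ %% _)%Z.
by rewrite -!shift.
Qed.

End Counting.

Local Close Scope ring_scope.
Local Open Scope group_scope.

(** * Basic sets and multipliers *)

Section Multipliers.
Variables (gT gT' : finGroupType) (e : gT -> gT' -> bool).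
Hypotheses (cG : abelian [set: gT]) (cG' : abelian [set: gT']).
Hypothesis se : schur_rel e.

Local Notation csets := (schur_csets e).
Local Notation blk := (schur_blk e).
Local Notation im := (schur_im e).
Local Notation aset := (schur_aset e).

Lemma srel11 : e 1%g 1%g.
Proof.
have [x' ex'] := srel_total se 1%g.
by have := srel_one se ex'; rewrite eqxx => /esym/eqP <-.
Qed.

Lemma srel1P x' : e 1%g x' -> x' = 1%g.
Proof. by move/(srel_one se); rewrite eqxx => /esym/eqP. Qed.

Lemma mem_blk x x' y : e x x' -> (y \in blk x) = e y x'.
Proof.
move=> exx'; rewrite inE; apply/existsP/idP => [[z' /andP[exz' eyz']]|eyx'].
  exact: (srel_difun se eyz' exz' exx').
by exists x'; rewrite exx'.
Qed.

Lemma csets_blk x : csets (blk x) (im x).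
Proof.
move=> y y' eyy'; rewrite !inE; apply/existsP/idP => [[x' /andP[exx' eyx']]|exy'].
  exact: (srel_difun se exx' eyx' eyy').
by exists y'; rewrite exy'.
Qed.

Lemma blk_refl x : x \in blk x.
Proof. by have [x' exx'] := srel_total se x; rewrite (mem_blk _ exx'). Qed.

Lemma blk_eq x y : y \in blk x -> blk y = blk x.
Proof.
have [x' exx'] := srel_total se x; rewrite (mem_blk _ exx') => eyx'.
by apply/setP => z; rewrite (mem_blk _ exx') (mem_blk _ eyx').
Qed.

Lemma blk_sym x y : (y \in blk x) = (x \in blk y).
Proof. by apply/idP/idP => /blk_eq ->; apply: blk_refl. Qed.

Lemma blk1 : blk 1 = [set 1%g].
Proof.
apply/setP => y; rewrite (mem_blk _ srel11) inE.
by apply/idP/eqP => [/(srel_one se)|->]; [rewrite eqxx => /eqP | apply: srel11].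
Qed.

Lemma asetP (U : {set gT}) : reflect (forall x y, x \in U -> y \in blk x -> y \in U) (aset U).
Proof.
apply: (iffP forallP) => [aU x y xU yx | aU x].
  by have /implyP/(_ xU)/subsetP/(_ _ yx) := aU x.
by apply/implyP => xU; apply/subsetP => y; apply: aU.
Qed.

Lemma csets_aset U U' : csets U U' -> aset U.
Proof.
move=> UU'; apply/asetP => x y; have [x' exx'] := srel_total se x.
by rewrite (mem_blk _ exx') (UU' _ _ exx') => xU' /UU' ->.
Qed.

Lemma aset_csets U : aset U -> csets U (\bigcup_(x in U) im x).
Proof.
move=> /asetP aU x x' exx'; apply/idP/bigcupP => [xU|[y yU]].
  by exists x; rewrite ?inE.
by rewrite inE => eyx'; apply: aU yU _; rewrite (mem_blk _ eyx').
Qed.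

Lemma csets_inj U U' V' : csets U U' -> csets U V' -> U' = V'.
Proof.
move=> UU' UV'; apply/setP => x'; have [x exx'] := srel_surj se x'.
by rewrite -(UU' _ _ exx') (UV' _ _ exx').
Qed.

Lemma csets_mul U U' V V' :
  csets U U' -> csets V V' -> csets (U * V)%g (U' * V')%g.
Proof.
have mulP (hT : finGroupType) (A B : {set hT}) g :
    (g \in (A * B)%g) = (0 < #|[set u in A | (u^-1 * g)%g \in B]|)%N.
  apply/mulsgP/card_gt0P => [[a b aA bB ->]|[a]].
    by exists a; rewrite inE aA mulKg.
  by rewrite inE => /andP[aA agB]; exists a (a^-1 * g)%g; rewrite ?mulKVg.
by move=> UU' VV' g g' egg'; rewrite !mulP (csets_mul_card se UU' VV' egg').
Qed.

Lemma csetsT : csets setT setT. Proof. by move=> x x'; rewrite !inE. Qed.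

Lemma csets_card U U' : csets U U' -> #|U| = #|U'|.
Proof.
(* With the whole group as second factor, the coefficient of the product at 1 is the cardinal of the
   first. *)
have full (hT : finGroupType) (A : {set hT}) :
    [set u in A | (u^-1 * 1)%g \in [set: hT]] = A.
  by apply/setP => u; rewrite !inE andbT.
by move=> UU'; have := csets_mul_card se UU' csetsT srel11; rewrite !full.
Qed.

Lemma card_srel : #|gT| = #|gT'|.
Proof. by have := csets_card csetsT; rewrite !cardsT. Qed.

Lemma aset_mul U V : aset U -> aset V -> aset (U * V)%g.
Proof. by move=> /aset_csets aU /aset_csets aV; apply: csets_aset (csets_mul aU aV). Qed.

Lemma aset_blk x : aset (blk x).
Proof. exact: csets_aset (csets_blk x). Qed.

Lemma aset1 : aset [set 1%g]. Proof. by rewrite -blk1 aset_blk. Qed.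

Lemma asetU U V : aset U -> aset V -> aset (U :|: V).
Proof.
move=> /asetP aU /asetP aV; apply/asetP => x y.
rewrite !in_setU => /orP[xU|xV] yx; first by rewrite (aU _ _ xU yx).
by rewrite (aV _ _ xV yx) orbT.
Qed.

Lemma aset_gen U : aset U -> aset <<U>>.
Proof.
move=> aU; have [n ->] := gen_expgs U.
elim: n => [|n IHn]; first by rewrite expg0 aset1.
by rewrite expgS aset_mul ?asetU ?aset1.
Qed.

Lemma aset_subset_blk U x : aset U -> x \in U -> blk x \subset U.
Proof. by move=> /asetP aU xU; apply/subsetP => y; apply: aU. Qed.

Lemma aset_group_csets (D : {group gT}) : aset D -> exists D' : {group gT'}, csets D D'.
Proof.
move=> /aset_csets; set D' := \bigcup_(x in D) im x => DD'.
suff gD' : group_set D' by exists (Group gD').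
apply/group_setP; split; first by rewrite -(DD' _ _ srel11) group1.
move=> x y xD' yD'.
have := csets_mul DD' DD'; rewrite mulGid => /(csets_inj DD') ->.
exact: mem_mulg.
Qed.

Definition pow_set (hT : finGroupType) (U : {set hT}) m := [set (x ^+ m)%g | x in U].

(** As m is prime to the order, each g has at most one m-th root in U, so the number of roots modulo
    m, which [e] respects, decides whether g is an m-th power of an element of U. *)
Lemma csets_pow_prime m U U' : prime m -> coprime #|gT| m ->
  csets U U' -> csets (pow_set U m) (pow_set U' m).
Proof.
have powP (hT : finGroupType) (V : {set hT}) g : prime m -> coprime #|hT| m ->
    (g \in pow_set V m) = (#|[set x in V | (x ^+ (m ^ 1)%N)%g == g]| %% m != 0)%N.
  move=> m_pr co_m; rewrite expn1.
  have inj : injective (fun x : hT => (x ^+ m)%g).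
    move=> x y xy; have co : coprime #|[set: hT]| m by rewrite cardsT.
    by rewrite -(expgK co (in_setT x)) -(expgK co (in_setT y)) /= xy.
  apply/imsetP/idP => [[x xV ->]|].
    rewrite (_ : [set _ in _ | _] = [set x]) ?cards1 ?modn_small ?prime_gt1 //.
    apply/setP => y; rewrite !inE (inj_eq inj).
    by case: eqP => [->|]; rewrite ?xV ?andbF.
  case: (set_0Vmem [set x in V | (x ^+ m)%g == g]) => [->|[x]].
    by rewrite cards0 mod0n.
  by rewrite inE => /andP[xV /eqP <-] _; exists x.
move=> m_pr co_m UU' x x' exx'.
by rewrite !powP -?card_srel // (csets_pow_card cG cG' se 1 m_pr UU' exx').
Qed.

Lemma csets_pow m U U' : (0 < m)%N -> coprime #|gT| m ->
  csets U U' -> csets (pow_set U m) (pow_set U' m).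
Proof.
move: U U'; have [n] := ubnP m; elim: n m => // n IHn m lt_mn U U' m_gt0 co_m UU'.
have [m_le1|m_gt1] := leqP m 1.
  have -> : m = 1%N by lia.
  by rewrite /pow_set !(eq_imset (g := id)) ?imset_id.
have [q m_eq] := dvdnP (pdiv_dvd m); have q_gt0 : (0 < q)%N by case: q m_eq; lia.
have pow_setM (hT : finGroupType) (V : {set hT}) :
    pow_set V m = pow_set (pow_set V q) (pdiv m).
  by rewrite /pow_set -imset_comp; apply: eq_imset => x /=; rewrite -expgM -m_eq.
have p_gt1 := prime_gt1 (pdiv_prime m_gt1).
move: co_m; rewrite {1}m_eq coprimeMr => /andP[co_q co_p].
rewrite !pow_setM; apply: csets_pow_prime => //; first exact: pdiv_prime.
by apply: IHn => //; move: lt_mn; rewrite {1}m_eq; nia.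
Qed.

(** An inverse of m modulo the group order, by Euler's theorem. It is stated for all groups of that
    order because it is used on both sides of [e]. *)
Lemma expg_coprime_inv m : coprime #|gT| m -> (0 < m)%N ->
  exists n, [/\ (0 < n)%N, coprime #|gT| n
    & forall hT : finGroupType, #|hT| = #|gT| -> forall x : hT, (x ^+ (m * n)%N = x)%g].
Proof.
move=> co_m m_gt0; exists (m ^ (totient #|gT|).-1)%N; split.
- by rewrite expn_gt0 m_gt0.
- exact: coprimeXr.
move=> hT cardT x.
have N_gt0 : (0 < #|gT|)%N by apply/card_gt0P; exists 1%g.
rewrite -expnS prednK ?totient_gt0 //.
have xN : (x ^+ #|gT| = 1)%g by rewrite -cardT -cardsT expg_cardG ?inE.
rewrite -[LHS](expg_mod _ xN) Euler_exp_totient 1?coprime_sym //.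
by rewrite (expg_mod _ xN).
Qed.

(* Schur's theorem on multipliers. *)
Lemma srel_expg x x' m : coprime #|gT| m -> e x x' -> e (x ^+ m)%g (x' ^+ m)%g.
Proof.
move=> co_m exx'; case: (posnP m) => [->|m_gt0]; first by rewrite !expg0 srel11.
have [n [n_gt0 co_n powK]] := expg_coprime_inv co_m m_gt0.
have := csets_pow n_gt0 co_n (csets_blk (x ^+ m)%g) exx'.
have -> : x \in pow_set (blk (x ^+ m)%g) n.
  by apply/imsetP; exists (x ^+ m)%g; rewrite ?blk_refl // -expgM powK.
move/esym/imsetP => [y']; rewrite inE => ey' ->.
by rewrite -expgM mulnC powK // card_srel.
Qed.

Lemma blk_expg x y m : coprime #|gT| m -> y \in blk x -> (y ^+ m)%g \in blk (x ^+ m)%g.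
Proof.
move=> co_m; have [x' exx'] := srel_total se x; rewrite (mem_blk _ exx') => eyx'.
by rewrite (mem_blk _ (srel_expg co_m exx')) srel_expg.
Qed.

Lemma srelV x x' : e x x' -> e x^-1%g x'^-1%g.
Proof.
(* Inversion is the multiplier 2N - 1, where N is the group order; it is prime to N. *)
have expV (hT : finGroupType) (h : hT) : (h^-1 = h ^+ (#|hT| * 2)%N.-1)%g.
  apply/eqP; rewrite eq_invg_mul -expgS prednK.
    by rewrite expgM -cardsT expg_cardG ?inE ?expg1n.
  by rewrite muln_gt0 andbT; apply/card_gt0P; exists 1%g.
move=> exx'; rewrite !expV -card_srel; apply: srel_expg => //.
have : (0 < #|gT|)%N by apply/card_gt0P; exists 1%g.
case: #|gT| => // n _; have -> : (n.+1 * 2)%N.-1 = (n + n.+1)%N by lia.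
by rewrite /coprime gcdnDr -/(coprime _ _) coprimeSn.
Qed.

Lemma csetsV U U' : csets U U' -> csets (U^-1)%g (U'^-1)%g.
Proof. by move=> UU' x x' exx'; rewrite !mem_invg (UU' _ _ (srelV exx')). Qed.

End Multipliers.

(** * Radicals and quotients *)

Section Radical.
Variable hT : finGroupType.
Implicit Types (X : {set hT}) (x d : hT).

Definition srad X := [set d | X :* d == X].

Lemma srad_group_set X : group_set (srad X).
Proof.
apply/group_setP; split=> [|c d]; first by rewrite inE mulg1.
by rewrite !inE rcosetM => /eqP-> /eqP->.
Qed.
Canonical srad_group X := Group (srad_group_set X).

Lemma mem_srad X x d : d \in srad X -> (x * d \in X) = (x \in X).
Proof. by rewrite inE => /eqP Xd; rewrite -{1}Xd mem_rcoset mulgK. Qed.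

Lemma sradI X d : (forall x, x \in X -> x * d \in X) -> d \in srad X.
Proof.
move=> Xd; rewrite inE eqEcard card_rcoset leqnn andbT.
by apply/subsetP => _ /rcosetP[x xX ->]; apply: Xd.
Qed.

End Radical.

Section Cosets.
Variables (hT : finGroupType) (cH : abelian [set: hT]) (D : {group hT}).
Implicit Types x y : hT.

Lemma mem_norm_abelian x : x \in 'N(D).
Proof. by rewrite (subsetP (sub_abelian_norm cH (subsetT D))) ?inE. Qed.

Lemma coset_eqE x y : (coset D x == coset D y) = (x^-1 * y \in D).
Proof.
apply/eqP/idP => [|xyD].
  move/(rcoset_kercosetP (mem_norm_abelian x) (mem_norm_abelian y)).
  by rewrite mem_rcoset -groupV invMg invgK abelian_setT_mulC.
apply/(rcoset_kercosetP (mem_norm_abelian x) (mem_norm_abelian y)).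
by rewrite mem_rcoset -groupV invMg invgK abelian_setT_mulC.
Qed.

Lemma coset_eq1 x : (coset D x == 1) = (x \in D).
Proof. by rewrite -(morph1 [morphism of coset D]) coset_eqE mulg1 groupV. Qed.

Lemma cosetMT x y : coset D (x * y) = coset D x * coset D y.
Proof. by rewrite morphM ?mem_norm_abelian. Qed.

Lemma cosetVT x : coset D x^-1 = (coset D x)^-1.
Proof. by rewrite morphV ?mem_norm_abelian. Qed.

Lemma cosetXT x n : coset D (x ^+ n) = coset D x ^+ n.
Proof. by rewrite morphX ?mem_norm_abelian. Qed.

Lemma abelian_coset_setT : abelian [set: coset_of D].
Proof.
apply/centsP => u _ v _; rewrite -(coset_reprK u) -(coset_reprK v).
by rewrite /commute -!cosetMT (abelian_setT_mulC cH).
Qed.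

Definition gr_lift (a : group_ring (coset_of D)) : group_ring hT :=
  [ffun g => a (coset D g)].

(** Each coset contributes its #|D| elements equally. Compatibility of products in a quotient thus
    follows from compatibility upstairs, after division by #|D|. *)
Lemma gr_lift_mul (a b : group_ring (coset_of D)) (g : hT) :
  (gr_lift a * gr_lift b)%R g = ((a * b)%R (coset D g) *+ #|D|)%R.
Proof.
rewrite !gr_mulE (partition_big (coset D) xpredT) //= -sumrMnl.
apply: eq_bigr => u _; rewrite -[u]coset_reprK.
have -> : #|D| = #|[set h | coset D h == coset D (repr u)]|.
  rewrite -(card_lcoset D (repr u)); congr #|pred_of_set _|; apply/setP => h.
  by rewrite inE mem_lcoset eq_sym coset_eqE.
rewrite -sumr_const; apply: congr_big => // h; first by rewrite inE.
by move/eqP => hu; rewrite !ffunE cosetMT cosetVT hu.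
Qed.

End Cosets.

Section RadicalsQuotients.
Variables (gT gT' : finGroupType) (e : gT -> gT' -> bool).
Hypotheses (cG : abelian [set: gT]) (cG' : abelian [set: gT']).
Hypothesis se : schur_rel e.

Local Notation compat := (schur_compat e).
Local Notation csets := (schur_csets e).
Local Notation blk := (schur_blk e).
Local Notation im := (schur_im e).
Local Notation aset := (schur_aset e).

(** Membership of d in the radical is read off a product: it holds iff the coefficient of d in the
    product of X^-1 and X reaches its maximum #|X|. *)
Lemma csets_srad X X' : csets X X' -> csets (srad X) (srad X').
Proof.
have radP (hT : finGroupType) (Y : {set hT}) d :
    (d \in srad Y) = (#|[set v in Y^-1 | v^-1 * d \in Y]| == #|Y|).
  apply/idP/eqP => [dY|/eqP].
    rewrite -[RHS](card_invg Y); apply: eq_card => v; rewrite !inE.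
    by case: (boolP (v^-1 \in Y)) => //= vY; rewrite mem_srad.
  rewrite -(card_invg Y) => /eqP cY; apply: sradI => x xY.
  have : x^-1 \in [set v in Y^-1 | v^-1 * d \in Y].
    suff -> : [set v in Y^-1 | v^-1 * d \in Y] = Y^-1 by rewrite inE invgK.
    apply/eqP; rewrite eqEcard cY leqnn andbT.
    by apply/subsetP => v; rewrite !inE => /andP[].
  by rewrite !inE invgK => /andP[].
move=> XX' d d' edd'.
by rewrite !radP (csets_mul_card se (csetsV cG cG' se XX') XX' edd') (csets_card se XX').
Qed.

Lemma aset_srad X : aset X -> aset (srad X).
Proof. by move/(aset_csets se)/csets_srad/(csets_aset se). Qed.

Definition modrel (L : {set gT}) (x : gT) (x' : gT') := [exists l in L, e (x * l) x'].

Section Quotient.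
Variables (D : {group gT}) (D' : {group gT'}).
Hypothesis DD' : csets D D'.

(** The ambiguity modulo D can be moved to the side of G', because the products [blk x * D] and
    [im x * D'] correspond under [e]. *)
Lemma modrelP x x' : reflect (exists2 d', d' \in D' & e x (x' * d')) (modrel D x x').
Proof.
apply: (iffP exists_inP) => [[d dD exdx']|[d' dD' exx'd']].
  have := csets_mul se (csets_blk se x) DD' exdx'.
  have -> : x * d \in blk x * D by rewrite mem_mulg ?blk_refl.
  move/esym/mulsgP => [y' d']; rewrite inE => exy' d'D' x'E.
  by exists d'^-1; rewrite ?groupV // x'E mulgK.
have [y eyx'] := srel_surj se x'.
have := csets_mul se (csets_blk se y) DD' exx'd'.
have -> : x' * d' \in im y * D' by rewrite mem_mulg ?inE.
move/mulsgP => [z d]; rewrite (mem_blk se _ eyx') => ezx' dD xE.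
by exists d^-1; rewrite ?groupV // xE mulgK.
Qed.

Definition qrel (u : coset_of D) (u' : coset_of D') :=
  [exists x, [exists x', [&& coset D x == u, coset D' x' == u' & e x x']]].

Lemma qrelE x x' : qrel (coset D x) (coset D' x') = modrel D x x'.
Proof.
apply/existsP/idP => [[y /existsP[y' /and3P[]]]|/exists_inP[d dD exd]].
  rewrite eq_sym (coset_eqE cG) => xyD; rewrite eq_sym (coset_eqE cG') => xyD' eyy'.
  have /modrelP/exists_inP[d dD eyd] : exists2 d', d' \in D' & e y (x' * d').
    by exists (x'^-1 * y') => //; rewrite mulKVg.
  apply/exists_inP; exists (x^-1 * y * d); first exact: groupM.
  by rewrite !mulgA mulgV mul1g.
exists (x * d); apply/existsP; exists x'.
by rewrite exd eqxx andbT eq_sym (coset_eqE cG) mulKg dD.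
Qed.

Lemma srel_quotient : schur_rel qrel.
Proof.
have modrel_l x y x' : x^-1 * y \in D -> modrel D x x' = modrel D y x'.
  by rewrite -(coset_eqE cG) => /eqP xy; rewrite -!qrelE xy.
split=> [u|u'|u v u' v'|u u'|a b a' b' aa' bb' u u'].
- have [x' ex'] := srel_total se (repr u).
  exists (coset D' x'); rewrite -[u]coset_reprK qrelE.
  by apply/modrelP; exists 1; rewrite ?mulg1 ?group1.
- have [x ex'] := srel_surj se (repr u').
  exists (coset D x); rewrite -[u']coset_reprK qrelE.
  by apply/modrelP; exists 1; rewrite ?mulg1 ?group1.
- rewrite -[u]coset_reprK -[v]coset_reprK -[u']coset_reprK -[v']coset_reprK !qrelE.
  move: (repr u) (repr v) (repr u') (repr v') => x y x' y'.
  move=> /modrelP[d1 d1D' exx'] /modrelP[d2 d2D' eyx'].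
  have /modrelP/exists_inP[d dD eydx'] : exists2 d', d' \in D' & e y (x' * d1 * d').
    by exists (d1^-1 * d2); rewrite ?groupM ?groupV // -mulgA mulKVg.
  rewrite (modrel_l y (y * d)) ?mulKg // => /modrelP[d3 d3D' eydy'].
  by apply/modrelP; exists d3 => //; apply: srel_difun se _ _ _ _ exx' eydx' eydy'.
- rewrite -[u]coset_reprK -[u']coset_reprK qrelE (coset_eq1 cG) (coset_eq1 cG').
  case/exists_inP => d dD /DD' <-.
  by rewrite groupMr.
have lift_compat c c' : schur_compat qrel c c' -> compat (gr_lift c) (gr_lift c').
  move=> cc' x x' exx'; rewrite !ffunE; apply: cc'; rewrite qrelE.
  by apply/modrelP; exists 1; rewrite ?mulg1 ?group1.
rewrite -[u]coset_reprK -[u']coset_reprK qrelE => /modrelP[d' dD' exx'].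
have := srel_mul se (lift_compat _ _ aa') (lift_compat _ _ bb') exx'.
rewrite (gr_lift_mul cG) (gr_lift_mul cG') (csets_card se DD').
have -> : coset D' (repr u' * d') = coset D' (repr u').
  by apply/eqP; rewrite eq_sym (coset_eqE cG') mulKg.
move/eqP; rewrite -subr_eq0 -mulrnBl mulrn_eq0 subr_eq0.
by rewrite (negbTE (lt0n_neq0 (cardG_gt0 D'))) => /eqP.
Qed.

End Quotient.

End RadicalsQuotients.

(** * Basic sets over cyclic p-groups *)

Section CyclicPGroup.
Variables (p : nat) (hT : finGroupType).
Hypotheses (p_pr : prime p) (pH : p.-group [set: hT]).
Implicit Types (x y z : hT) (B : {group hT}).

Lemma coprime_pgroup k : ~~ (p %| k) -> coprime #|hT| k.
Proof.
move=> pk; rewrite -cardsT; apply: (pnat_coprime pH).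
by rewrite p'natE.
Qed.

Lemma order_pgroup x : exists n, #[x] = (p ^ n)%N.
Proof.
have : p.-elt x by apply: (mem_p_elt pH); rewrite inE.
by case/p_natP=> // n ->; exists n.
Qed.

Lemma cycle_expg_coprime x k : ~~ (p %| k) -> <[x ^+ k]> = <[x]>.
Proof.
move=> pk; apply/esym/eqP; have := generator_coprime x k; rewrite /generator => ->.
apply: coprime_dvdl (coprime_pgroup pk).
by rewrite -cardsT order_dvdG ?inE.
Qed.

Lemma mem_cycle_expp x y : y \in <[x]> -> (<[y]> = <[x]>) \/ y \in <[x ^+ p]>.
Proof.
case/cycleP => k ->; case: (boolP (p %| k)) => [/dvdnP[j ->]|pk].
  by right; rewrite mulnC expgM mem_cycle.
by left; apply: cycle_expg_coprime.
Qed.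

Lemma cycle_expp_proper x : x != 1 -> x \notin <[x ^+ p]>.
Proof.
move=> x1; apply/negP; rewrite -cycle_subG => /subset_leq_card.
have [n xn] := order_pgroup x.
have n_gt0 : (0 < n)%N.
  by case: n xn => // /eqP; rewrite expn0 order_eq1 (negbTE x1).
have := orderXdiv; rewrite -!orderE => /(_ _ x p) ->; last first.
  by rewrite xn dvdn_exp.
by rewrite leqNgt ltn_Pdiv ?prime_gt1 ?order_gt0.
Qed.

Lemma subgroup_cycle_expp x B :
  B \subset <[x]> -> B :!=: <[x]> -> B \subset <[x ^+ p]>.
Proof.
move=> Bx BNx; apply/subsetP => y yB.
case: (mem_cycle_expp (subsetP Bx y yB)) => // yx.
by case/negP: BNx; rewrite eqEsubset Bx -yx cycle_subG.
Qed.

Lemma cycle_eq_expg x y :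
  <[y]> = <[x]> -> exists2 k, ~~ (p %| k) & y = x ^+ k.
Proof.
move=> yx; have /cycleP[k yk] : y \in <[x]> by rewrite -yx cycle_id.
case: (eqVneq x 1) => [x1|x1].
  by exists 1%N; rewrite ?expg1 ?dvdn1 ?neq_ltn ?prime_gt1 ?orbT // yk x1 expg1n.
exists k => //; apply/negP => /dvdnP[j kj].
case/negP: (cycle_expp_proper x1); rewrite -cycle_subG -yx cycle_subG.
by rewrite yk kj mulnC expgM mem_cycle.
Qed.

Lemma cycle_sub_dvd x y z : y \in <[x]> -> z \in <[x]> ->
  #[y] %| #[z] -> y \in <[z]>.
Proof.
move=> yx zx; rewrite !orderE (cardSg_cyclic (cycle_cyclic x)) ?cycle_subG //.
Qed.

Lemma order_expg_div x : x != 1 -> #[x ^+ (#[x] %/ p)] = p.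
Proof.
move=> x1; have [n xn] := order_pgroup x.
have pd : (p %| #[x]).
  case: n xn => [/eqP|n ->]; last exact: dvdn_exp.
  by rewrite expn0 order_eq1 (negbTE x1).
by rewrite orderXdiv ?divn_dvd ?dvdn_div // divnA ?mulKn ?order_gt0.
Qed.

Lemma expg_div_mem x B : B \subset <[x]> -> B :!=: 1 -> x ^+ (#[x] %/ p) \in B.
Proof.
move=> Bx B1; have x1 : x != 1.
  by apply: contraNneq B1 => x1; rewrite -subG1 -(cycle1 hT) -x1.
rewrite -cycle_subG -(cardSg_cyclic (cycle_cyclic x)) ?cycleX // -orderE order_expg_div //.
have pB : p.-group B by apply: pgroupS pH; apply: subsetT.
by case/pgroup_pdiv: pB.
Qed.

End CyclicPGroup.

Section PGroup.
Variables (gT gT' : finGroupType) (e : gT -> gT' -> bool).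
Hypotheses (cG : abelian [set: gT]) (cG' : abelian [set: gT']).
Hypothesis se : schur_rel e.

Local Notation blk := (schur_blk e).
Local Notation aset := (schur_aset e).

Variable p : nat.
Hypotheses (p_pr : prime p) (pG : p.-group [set: gT]).

Lemma blk_expgE x y k : ~~ (p %| k) -> (y ^+ k \in blk (x ^+ k)) = (y \in blk x).
Proof.
move=> pk; have co_k := coprime_pgroup p_pr pG pk.
apply/idP/idP; last exact: blk_expg cG cG' se _ _ _ co_k.
have k_gt0 : (0 < k)%N by case: k pk {co_k} => //; rewrite dvdn0.
have [n [_ co_n powK]] := expg_coprime_inv co_k k_gt0.
by move/(blk_expg cG cG' se co_n); rewrite -!expgM !powK.
Qed.

Lemma card_blkI_expg (Q : {set gT}) x k : ~~ (p %| k) ->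
  (forall y, y \in Q -> y ^+ k \in Q) ->
  #|blk x :&: Q| <= #|blk (x ^+ k) :&: Q|.
Proof.
move=> pk Qk; have co_k := coprime_pgroup p_pr pG pk.
have k_gt0 : (0 < k)%N by case: k pk {Qk co_k} => //; rewrite dvdn0.
have [n [_ co_n powK]] := expg_coprime_inv co_k k_gt0.
rewrite -(card_in_imset (f := fun y => y ^+ k) (D := blk x :&: Q)).
  apply/subset_leq_card/subsetP => _ /imsetP[y /setIP[yx yQ] ->].
  by rewrite inE blk_expgE // yx Qk.
by move=> y z _ _ /(congr1 (fun u => u ^+ n)); rewrite -!expgM !powK.
Qed.

(* The basic sets containing a generator of <[x]> are the powers of blk x, so
   generators make up the same proportion of each of them, which is at least
   their proportion in <[x]>. *)
Lemma card_blk_generators x : aset <[x]> ->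
  #|blk x| <= (#|blk x :&: [set y | generator <[x]> y]|).*2.
Proof.
move=> aH; set Gn := [set y | _]; set r := #|_ :&: _|.
have GnP y : y \in Gn -> <[y]> = <[x]> by rewrite inE => /eqP.
have Gn_pow k y : ~~ (p %| k) -> y \in Gn -> y ^+ k \in Gn.
  by move=> pk; rewrite !inE /generator => /eqP->; rewrite (cycle_expg_coprime p_pr pG).
have low y : y \in Gn -> #|blk x| <= #|blk y|.
  move/GnP/(cycle_eq_expg p_pr pG) => [k pk ->].
  by have := @card_blkI_expg setT x k pk; rewrite !setIT; apply=> *; rewrite inE.
have high h : #|blk h :&: Gn| <= r.
  have [->|[y /setIP[yh yGn]]] := set_0Vmem (blk h :&: Gn); first by rewrite cards0.
  have [k pk xy] := cycle_eq_expg p_pr pG (esym (GnP _ yGn)).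
  by rewrite -(blk_eq se yh) /r {1}xy card_blkI_expg // => z; apply: Gn_pow.
have count : #|Gn| * #|blk x| <= #|<[x]>| * r.
  rewrite -!sum_nat_const.
  apply: (@leq_trans (\sum_(y in Gn) #|blk y|)); first exact: leq_sum.
  apply: (@leq_trans (\sum_(h in <[x]>) #|blk h :&: Gn|)); last exact: leq_sum.
  under eq_bigr do rewrite -sum1_card.
  under [X in _ <= X]eq_bigr do rewrite -sum1_card.
  rewrite [X in _ <= X](exchange_big_dep (mem Gn)) /=; last by move=> h y _ /setIP[].
  apply: leq_sum => y yGn; rewrite [X in X <= _]big_mkcond [X in _ <= X]big_mkcond.
  apply: leq_sum => h _ /=; rewrite in_setI yGn andbT [y \in _](blk_sym se).
  case: ifP => // hy; rewrite ifT // andbT.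
  have yH : y \in <[x]> by rewrite -cycle_subG (GnP _ yGn).
  exact: (subsetP (aset_subset_blk aH yH)).
have := totient_gen x; rewrite -/Gn => GnE.
have N_gt0 : 0 < #[x] by exact: order_gt0.
have : #[x] <= #|Gn|.*2.
  rewrite -GnE; have [[|n] ->] := order_pgroup pG x; first by rewrite expn0.
  rewrite totient_pfactor //= expnS -muln2 mulnAC leq_mul2r.
  by have := prime_gt1 p_pr; lia.
move: count; rewrite -orderE; move: N_gt0; clearbody r; clear.
by move: #|Gn| #|blk x| #[x] => a b c; nia.
Qed.

End PGroup.

(** * Basic sets of generators when the maximal subgroup is not an A-subgroup *)

Section TrivialRadicalWreath.
Variables (gT gT' : finGroupType) (e : gT -> gT' -> bool).
Hypotheses (cG : abelian [set: gT]) (cG' : abelian [set: gT']).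
Hypothesis se : schur_rel e.

Local Notation blk := (schur_blk e).
Local Notation aset := (schur_aset e).

Variable p : nat.
Hypotheses (p_pr : prime p) (pG : p.-group [set: gT]).

Local Notation E x := <[x ^+ (#[x] %/ p)]>.

(** The p-th roots of y ^+ p in [blk y] lie in the coset y * E, which has p elements. If their
    number were prime to p, then by root counting every element of the basic set of y ^+ p would be
    a p-th power from [blk y], so that basic set would generate [<[x ^+ p]>] and make it an
    A-subgroup. Hence p divides this nonzero number, and the whole coset is in [blk y]. *)
Lemma blk_gen_rcoset x : aset <[x]> -> ~~ aset <[x ^+ p]> ->
  forall y, <[y]> = <[x]> -> forall w, w \in E x -> y * w \in blk y.
Proof.
move=> aH naH y yx.
have oyx : #[y] = #[x] by rewrite !orderE yx.
have x1 : x != 1 by apply: contraNneq naH => ->; rewrite expg1n cycle1 (aset1 se).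
set S := [set t in blk y | t ^+ p == y ^+ p].
have SE : S \subset y *: E x.
  apply/subsetP => t; rewrite inE => /andP[ty /eqP tp].
  have yH : y \in <[x]> by rewrite -yx cycle_id.
  have tH : t \in <[x]> := subsetP (aset_subset_blk aH yH) t ty.
  rewrite mem_lcoset; apply: (cycle_sub_dvd (x := x)).
  - by rewrite groupM ?groupV.
  - exact: mem_cycle.
  rewrite (order_expg_div pG x1) order_dvdn.
  have cyt : commute y^-1 t by apply: abelian_setT_mulC.
  by rewrite expgMn // tp expgVn mulVg.
have cE : #|y *: E x| = p by rewrite card_lcoset -orderE (order_expg_div pG x1).
have pS : p %| #|S|.
  apply: contraR naH => pS.
  have bsub : blk (y ^+ p) \subset <[x ^+ p]>.
    apply/subsetP => v; have [y' eyy'] := srel_total se (y ^+ p).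
    rewrite (mem_blk se _ eyy') => evy'.
    have := csets_pow_card cG cG' se 1 p_pr (csets_blk se y) eyy'.
    rewrite -(csets_pow_card cG cG' se 1 p_pr (csets_blk se y) evy') expn1 -/S => Sv.
    case: (set_0Vmem [set t in blk y | t ^+ p == v]) Sv => [->|[t]].
      by rewrite cards0 mod0n => /eqP S0; case/negP: pS.
    rewrite inE => /andP[ty /eqP <-] _.
    have yH : y \in <[x]> by rewrite -yx cycle_id.
    have /cycleP[k ->] : t \in <[x]> := subsetP (aset_subset_blk aH yH) t ty.
    by rewrite -expgM mulnC expgM mem_cycle.
  have <- : <<blk (y ^+ p)>> = <[x ^+ p]>.
    apply/eqP; rewrite eqEsubset gen_subG bsub /=.
    have [k _ ->] := cycle_eq_expg p_pr pG (esym yx).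
    rewrite -expgM mulnC expgM cycle_subG groupX // mem_gen ?blk_refl //.
  by rewrite aset_gen ?aset_blk.
have SyE : S = y *: E x.
  apply/eqP; rewrite eqEcard SE cE dvdn_leq //.
  by apply/card_gt0P; exists y; rewrite inE (blk_refl se) eqxx.
move=> w wE; have : y * w \in S by rewrite SyE mem_lcoset mulKg.
by rewrite inE => /andP[].
Qed.

(* Schur's theorem that a primitive S-ring over a cyclic p-group of order > p
   is trivial, in relative form.  With T := blk x and H1 a minimal nontrivial
   A-subgroup, counting pairs of T in the same H1-coset gives
   |T| * lam >= |T| + (|H1| - 1) * |T| / 2, i.e. T contains more than half of
   each H1-coset it meets. *)
Lemma blk_rad1 x : aset <[x]> -> ~~ aset <[x ^+ p]> -> srad (blk x) = 1 ->
  blk x = <[x]> :\ 1.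
Proof.
move=> aH naH rad1; set T := blk x.
have x1 : x != 1 by apply: contraNneq naH => ->; rewrite expg1n cycle1 (aset1 se).
have shift := blk_gen_rcoset aH naH.
set Gn := [set y | generator <[x]> y].
have TH : T \subset <[x]> by rewrite aset_subset_blk ?cycle_id.
have [H1 minH1 H1x] : {H1 : {group gT} |
    [min H1 | aset H1 & H1 :!=: 1%g] & H1 \subset <[x]>}.
  by apply: mingroup_exists; rewrite aH cycle_eq1.
have [/andP[aH1 H1N1] H1min] := mingroupP minH1.
have zH1 : x ^+ (#[x] %/ p) \in H1 by rewrite (expg_div_mem pG).
have z1 : x ^+ (#[x] %/ p) != 1.
  by rewrite -order_eq1 (order_expg_div pG x1) neq_ltn prime_gt1 ?orbT.
have [h1 H1E] : exists h1, H1 :=: <[h1]>.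
  by apply/cyclicP; apply: cyclicS H1x (cycle_cyclic x).
(* By minimality, a nontrivial basic set inside [H1] generates [H1], so it is not contained in the
   maximal subgroup of [H1]. *)
have has_gen g : g \in H1 -> g != 1 -> exists2 y, y \in blk g & <[y]> = <[h1]>.
  move=> gH1 g1; have bH1 := aset_subset_blk aH1 gH1.
  have genH1 : <<blk g>> = H1.
    apply: H1min; last by rewrite gen_subG.
    rewrite aset_gen ?aset_blk //=; apply: contraNneq g1 => b1.
    by rewrite -in_set1 -[[set 1]]/(1%g : {set gT}) -b1 mem_gen ?blk_refl.
  have h1N1 : h1 != 1 by rewrite -cycle_eq1 -H1E.
  have : ~~ (blk g \subset <[h1 ^+ p]>).
    apply: contra (cycle_expp_proper p_pr pG h1N1) => bs.
    by rewrite -cycle_subG -H1E -genH1 gen_subG.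
  case/subsetPn => y yg yN; exists y => //.
  by case: (mem_cycle_expp p_pr pG (x := h1) (y := y)) => //;
    rewrite -?H1E ?(subsetP bH1) // (negbTE yN).
(* The basic set of a generator z of [E x] contains a generator of [H1]. A multiplier k sends the
   latter to a generator of [H1] in [blk g], hence z ^+ k lies in [blk g]. *)
have meetE g : g \in H1 -> g != 1 -> exists2 w, w \in E x & w \in blk g.
  move=> gH1 g1; have [y yg yh1] := has_gen g gH1 g1.
  have [y0 y0z y0h1] := has_gen _ zH1 z1.
  have [k pk yk] : exists2 k, ~~ (p %| k) & y = y0 ^+ k.
    by apply: (cycle_eq_expg p_pr pG); rewrite y0h1.
  exists ((x ^+ (#[x] %/ p)) ^+ k); first exact: mem_cycle.
  rewrite -(blk_eq se yg) yk (blk_expgE cG cG' se p_pr pG) //.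
  by rewrite (blk_sym se).
pose l u := #|[set a in T | a^-1 * u \in H1]|.
have lE u : u \in T -> l u = l x.
  have [x' exx'] := srel_total se x.
  have [H1' H1H1'] := aset_group_csets se aH1.
  rewrite (mem_blk se _ exx') => eux'.
  rewrite /l (csets_mul_card se (csets_blk se x) H1H1' exx').
  exact: csets_mul_card (csets_blk se x) H1H1' eux'.
pose c g := #|[set u in T | u * g \in T]|.
have cblk g w : w \in blk g -> c w = c g.
  have c_csets v : c v = #|[set u in T^-1 | u^-1 * v \in T]|.
    rewrite /c -card_invg; apply: eq_card => u.
    by rewrite mem_invg [LHS]inE [RHS]inE mem_invg invgK.
  have [g' egg'] := srel_total se g; rewrite (mem_blk se _ egg') => ewg'.
  have TT' := csets_blk se x; have TV := csetsV cG cG' se TT'.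
  by rewrite !c_csets (csets_mul_card se TV TT' ewg') (csets_mul_card se TV TT' egg').
(* Replacing g by a [w] in [E x] from the same basic set does not change [c], and by
   [blk_gen_rcoset] every generator t in [T] satisfies t * w in [blk t], which is [T]. *)
have cE g : g \in H1 -> g != 1 -> #|T :&: Gn| <= c g.
  move=> gH1 g1; have [w wE wg] := meetE g gH1 g1; rewrite -(cblk g w wg).
  apply/subset_leq_card/subsetP => t /setIP[tT tG]; rewrite in_set tT /=.
  have tx : <[t]> = <[x]> by move: tG; rewrite in_set => /eqP.
  by rewrite /T -(blk_eq se tT) shift.
have sumE : \sum_(g in H1) c g = (#|T| * l x)%N.
  rewrite -sum_nat_const -(eq_bigr _ (fun u uT => lE u uT)).
  rewrite /c; under eq_bigr do rewrite -sum1_card.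
  rewrite (exchange_big_dep (mem T)) /=; last by move=> g u _; rewrite inE => /andP[].
  apply: eq_bigr => u uT; rewrite sum1dep_card /l -(card_imset _ (mulgI u)).
  apply: eq_card => a; rewrite inE; apply/imsetP/andP => [[g]|[aT auH1]].
    rewrite 2!in_set uT /= => /andP[gH1 ugT] ->.
    by rewrite ugT -groupV invMg !invgK mulKg.
  exists (u^-1 * a); last by rewrite mulKVg.
  by rewrite 2!in_set uT mulKVg aT !andbT -groupV invMg invgK.
have T_gt0 : 0 < #|T| by apply/card_gt0P; exists x; apply: blk_refl.
have big : #|H1| < (l x).*2.
  have T2r : #|T| <= (#|T :&: Gn|).*2 := card_blk_generators cG cG' se p_pr pG aH.
  have : \sum_(g in H1) c g >= #|T| + (#|H1|.-1 * #|T :&: Gn|)%N.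
    rewrite (bigD1 1) //=; apply: leq_add.
      by apply: subset_leq_card; apply/subsetP => u uT; rewrite inE mulg1 andbb.
    rewrite (cardsD1 1 H1) group1 /= -sum_nat_const.
    rewrite [X in X <= _](eq_bigl (fun g => (g \in H1) && (g != 1))).
      by apply: leq_sum => g /andP[]; apply: cE.
    by move=> g; rewrite !inE andbC.
  rewrite sumE -leq_double -!muln2 => sum_le.
  rewrite -(leq_pmul2l T_gt0) mulnA.
  apply: leq_trans sum_le; rewrite mulnDl -(prednK (cardG_gt0 H1)) -addn2.
  by rewrite mulnDr addnC leq_add2l -mulnA muln2 mulnC leq_mul.
(* If [H1] is all of [<[x]>], then [T] is more than half of it. A nontrivial g outside [T] would
   have a basic set containing a generator, hence disjoint from [T] and at least as large: there is
   no room for it. *)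
case: (eqVneq (H1 : {set gT}) <[x]>) => [H1H | H1NH].
  have lT : l x = #|T|.
    apply: eq_card => a; rewrite inE andb_idr // => aT.
    by rewrite H1H groupM ?groupV ?cycle_id // (subsetP TH).
  apply/eqP; rewrite eqEsubset; apply/andP; split.
    apply/subsetP => y yT; rewrite !inE (subsetP TH) // andbT.
    apply: contraTneq yT => ->.
    by rewrite (blk_sym se) (blk1 se) inE.
  apply/subsetP => g /setD1P[g1]; rewrite -H1H => gH1.
  apply: contraTT big => gNT; rewrite -leqNgt lT.
  have [y yg yh1] := has_gen g gH1 g1.
  have [k pk yk] : exists2 k, ~~ (p %| k) & y = x ^+ k.
    by apply: (cycle_eq_expg p_pr pG); rewrite yh1 -H1E.
  have : #|T| <= #|blk g|.
    rewrite -(blk_eq se yg) yk.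
    have := @card_blkI_expg _ _ _ cG cG' se _ p_pr pG setT x k pk.
    by rewrite !setIT; apply=> *; rewrite inE.
  have : #|T| + #|blk g| <= #|H1|.
    rewrite -cardsUI (_ : T :&: blk g = set0) ?cards0 ?addn0.
      by apply: subset_leq_card; rewrite subUset aset_subset_blk // H1H TH.
    apply/setP => u; rewrite in_setI in_set0; apply/negP => /andP[ux ug].
    by case/negP: gNT; rewrite /T -(blk_eq se ux) (blk_eq se ug) blk_refl.
  by rewrite -addnn => sum_le Tg; apply: leq_trans sum_le; rewrite leq_add2l.
have H1xp : H1 \subset <[x ^+ p]> by apply: (subgroup_cycle_expp p_pr pG).
(* Suppose w in x H1 is outside [T]. For each k with x ^+ k in both [T] and x H1, the element w ^+ k
   is in x H1; it is outside [T], because k is prime to p and [blk (x ^+ k)] is [T]. So the part of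
   x H1 in [T] injects into its complement, against [big]. *)
have xH1T : x *: H1 \subset T.
  apply/subsetP => w wxH1; apply: contraTT big => wT; rewrite -leqNgt.
  pose I := [set k : 'I_#[x] | (x ^+ k \in T) && (x ^+ k \in x *: H1)].
  have gen u : u \in x *: H1 -> <[u]> = <[x]>.
    move=> /lcosetP[h hH1 ->].
    have : x * h \in <[x]> by rewrite groupM ?cycle_id // (subsetP H1x).
    case/(mem_cycle_expp p_pr pG) => // xh.
    case/negP: (cycle_expp_proper p_pr pG x1).
    by rewrite -(groupMr x (subsetP H1xp h hH1)).
  have lI : l x = #|I|.
    have inj : injective (fun k : 'I_#[x] => x ^+ k).
      by move=> i j /eqP; rewrite eq_expg_mod_order !modn_small // => /eqP/val_inj.
    rewrite -(card_imset _ inj); apply: eq_card => a; rewrite inE.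
    have axH1 : (a^-1 * x \in H1) = (a \in x *: H1).
      by rewrite mem_lcoset -groupV invMg invgK.
    rewrite axH1; apply/andP/imsetP => [[aT axH]|[k]]; last first.
      by rewrite in_set => /andP[xT xH] ->.
    have /cyclePmin[k k_lt aE] : a \in <[x]> by apply: (subsetP TH).
    by exists (Ordinal k_lt) => //; rewrite in_set /= -aE aT.
  have lTx : l x = #|T :&: x *: H1|.
    by apply: eq_card => a; rewrite in_set in_setI mem_lcoset -[X in _ && X]groupV invMg invgK.
  have wx := gen w wxH1.
  have : #|I| <= #|x *: H1 :\: T|.
    have inj : injective (fun k : 'I_#[x] => w ^+ k).
      have ow : #[w] = #[x] by rewrite !orderE wx.
      move=> i j /eqP; rewrite eq_expg_mod_order ow !modn_small //.
      by move/eqP/val_inj.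
    rewrite -(card_imset _ inj); apply/subset_leq_card/subsetP => _ /imsetP[k + ->].
    rewrite in_set in_setD => /andP[xkT xkH1]; apply/andP; split; last first.
      case/lcosetP: wxH1 => h hH1 ->; rewrite expgMn; last exact: abelian_setT_mulC.
      by move: xkH1; rewrite !mem_lcoset mulgA => xkH1; rewrite groupM ?groupX.
    apply: contra wT => wkT.
    have [j pj xj] := cycle_eq_expg p_pr pG (gen _ xkH1).
    have pk : ~~ (p %| k).
      apply: contra (cycle_expp_proper p_pr pG x1) => /dvdnP[m km].
      rewrite -cycle_subG -(gen _ xkH1) cycle_subG.
      by rewrite km mulnC expgM mem_cycle.
    by rewrite -(blk_expgE cG cG' se p_pr pG _ _ pk) (blk_eq se xkT).
  rewrite -lI; have := cardsID T (x *: H1); rewrite card_lcoset setIC -lTx.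
  by move=> <- lD; rewrite -addnn leq_add2l.
(* As [l] is constant on [T], every coset of [H1] that meets [T] is contained in [T], so the radical
   is not trivial after all. *)
suff H1r : H1 \subset srad T by move: H1N1; rewrite -subG1 -rad1 H1r.
apply/subsetP => h hH1; apply: sradI => t tT.
have lx : l x = #|H1|.
  rewrite -(card_lcoset H1 x); apply: eq_card => a.
  rewrite in_set -groupV invMg invgK -mem_lcoset andb_idl // => axH.
  exact: (subsetP xH1T).
have : [set a in T | a^-1 * t \in H1] = t *: H1.
  apply/eqP; rewrite eqEcard card_lcoset -lx -(lE t tT) leqnn andbT.
  apply/subsetP => a; rewrite in_set => /andP[_ atH1].
  by rewrite mem_lcoset -groupV invMg invgK.
move/setP/(_ (t * h)); rewrite mem_lcoset mulKg hH1 in_set.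
by case/andP.
Qed.

End TrivialRadicalWreath.

Section RadicalBlocks.
Variables (gT gT' : finGroupType) (e : gT -> gT' -> bool).
Hypotheses (cG : abelian [set: gT]) (cG' : abelian [set: gT']).
Hypothesis se : schur_rel e.

Local Notation csets := (schur_csets e).
Local Notation blk := (schur_blk e).
Local Notation aset := (schur_aset e).

Variable p : nat.
Hypotheses (p_pr : prime p) (pG : p.-group [set: gT]).

Lemma srad_sub_cycle x : aset <[x]> -> srad (blk x) \subset <[x]>.
Proof.
move=> aH; apply/subsetP => d dD.
have xd : x * d \in blk x by rewrite mem_srad ?blk_refl.
by rewrite -(groupMl d (cycle_id x)) (subsetP (aset_subset_blk aH (cycle_id x))).
Qed.

Lemma srad_blk_expp x : aset <[x]> -> x != 1 -> srad (blk x) \subset <[x ^+ p]>.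
Proof.
move=> aH x1; apply: (subgroup_cycle_expp p_pr pG); first exact: srad_sub_cycle.
apply: contraNneq x1 => DH.
have xD : x \in srad (blk x) by rewrite DH cycle_id.
have : x * x^-1 \in blk x by rewrite mem_srad ?groupV ?blk_refl.
by rewrite mulgV (blk_sym se) (blk1 se) inE.
Qed.

Section QuotientBlock.
Variables (D : {group gT}) (D' : {group gT'}).
Hypothesis DD' : csets D D'.
Local Notation q := (qrel e (D := D) (D' := D')).
Let sq : schur_rel q := srel_quotient cG cG' se DD'.

Lemma srel_coset x x' : e x x' -> q (coset D x) (coset D' x').
Proof.
move=> exx'; rewrite (qrelE cG cG' se DD'); apply/exists_inP.
by exists 1; rewrite ?group1 ?mulg1.
Qed.

Lemma mem_blk_coset x y :
  (coset D y \in schur_blk q (coset D x)) = [exists d in D, y * d \in blk x].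
Proof.
have [x' exx'] := srel_total se x.
rewrite (mem_blk sq _ (srel_coset exx')) (qrelE cG cG' se DD').
by apply: eq_existsb => d; rewrite (mem_blk se _ exx').
Qed.

Lemma aset_coset (W : {set coset_of D}) : schur_aset q W = aset [set g | coset D g \in W].
Proof.
apply/idP/idP => [/asetP aW | /asetP aW].
  apply/asetP => x y.
  move=> xW yx; rewrite inE; move: xW; rewrite inE => xW; apply: aW xW _; rewrite mem_blk_coset.
  by apply/exists_inP; exists 1; rewrite ?mulg1 ?group1.
apply/asetP => u v.
rewrite -[u]coset_reprK -[v]coset_reprK mem_blk_coset => uW /exists_inP[d dD vd].
have -> : coset D (repr v) = coset D (repr v * d).
  by apply/eqP; rewrite (coset_eqE cG) mulKg.
by have := aW _ _ _ vd; rewrite !inE; apply.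
Qed.

Lemma mem_cycle_coset x y : D \subset <[x]> ->
  (coset D y \in <[coset D x]>) = (y \in <[x]>).
Proof.
move=> Dx; apply/cycleP/idP => [[k]|/cycleP[k ->]].
  rewrite -(cosetXT cG) => /eqP; rewrite eq_sym (coset_eqE cG) => /(subsetP Dx).
  by rewrite groupMl // groupV mem_cycle.
by exists k; rewrite (cosetXT cG).
Qed.

Lemma aset_cycle_coset x : D \subset <[x]> -> schur_aset q <[coset D x]> = aset <[x]>.
Proof.
move=> Dx; rewrite aset_coset; congr (aset _).
by apply/setP => y; rewrite inE mem_cycle_coset.
Qed.

Lemma pgroup_coset : p.-group [set: coset_of D].
Proof.
suff -> : [set: coset_of D] = [set: gT] / D by apply: quotient_pgroup.
apply/setP => u; rewrite inE -[u]coset_reprK mem_quotient ?inE //.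
Qed.

End QuotientBlock.

Section RadicalQuotient.
Variables (x : gT) (D : {group gT}) (D' : {group gT'}).
Hypotheses (DD' : csets D D') (DE : D :=: srad (blk x)).
Local Notation q := (qrel e (D := D) (D' := D')).

Lemma mem_blk_coset_srad y :
  (coset D y \in schur_blk q (coset D x)) = (y \in blk x).
Proof.
rewrite (mem_blk_coset DD'); apply/exists_inP/idP => [[d dD]|yx].
  by rewrite mem_srad // -DE.
by exists 1; rewrite ?mulg1 ?group1.
Qed.

Lemma srad_coset : srad (schur_blk q (coset D x)) = 1.
Proof.
apply/trivgP/subsetP => u uR; rewrite inE -[u]coset_reprK (coset_eq1 cG).
suff : repr u \in srad (blk x) by rewrite -DE.
apply: sradI => y yx; rewrite -mem_blk_coset_srad (cosetMT cG) coset_reprK.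
by rewrite mem_srad // mem_blk_coset_srad.
Qed.

End RadicalQuotient.

(** Modulo its radical a basic set has trivial radical, so [blk_rad1] applies in the quotient. *)
Lemma blk_srad x : aset <[x]> -> ~~ aset <[x ^+ p]> ->
  blk x = <[x]> :\: srad (blk x).
Proof.
move=> aH naH.
have x1 : x != 1 by apply: contraNneq naH => ->; rewrite expg1n cycle1 (aset1 se).
pose D := srad_group (blk x); have DE : D :=: srad (blk x) by [].
have [D' DD'] : exists D' : {group gT'}, csets D D'.
  by apply: (aset_group_csets se); apply: aset_srad (aset_blk se x).
have Dxp := srad_blk_expp aH x1; have Dx := srad_sub_cycle aH.
have cQ := abelian_coset_setT cG D; have cQ' := abelian_coset_setT cG' D'.
have sq := srel_quotient cG cG' se DD'.
have := @blk_rad1 _ _ _ cQ cQ' sq p p_pr (pgroup_coset D) (coset D x).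
rewrite -(cosetXT cG) !(aset_cycle_coset DD') // => /(_ aH naH (srad_coset DD' DE)) bE.
apply/setP => y; rewrite -(mem_blk_coset_srad DD' DE) bE.
by rewrite in_setD1 in_setD (coset_eq1 cG) mem_cycle_coset.
Qed.

End RadicalBlocks.

(* 4 is needed for p = 2, as (1 + 2)^2 = 1 + 2 * 2 * 2. *)
Definition lmod p := if p == 2 then 4 else p.

(** Raising 1 + v to the p-th power multiplies v by p, up to a factor prime to p. For odd p, all
    binomial terms past the linear one are divisible by p * p * v: the inner ones because p divides
    the coefficient, the last because p >= 3. *)
Lemma expn_1D_prime p v : prime p -> lmod p %| v ->
  exists2 w, ~~ (p %| w) & ((1 + v) ^ p = 1 + p * v * w)%N.
Proof.
rewrite /lmod => p_pr; case: eqP => [-> /dvdnP[c ->]|pN2].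
  by exists (1 + 2 * c)%N; [rewrite dvdn2; lia | nia].
have p_gt1 := prime_gt1 p_pr.
have [q qE] : exists q, p = q.+3 by exists (p - 3)%N; lia.
move=> pv.
have [t tE] : exists t,
    (\sum_(i < q.+2) 'C(p, i.+2) * v ^ i.+2 = p * p * v * t)%N.
  suff /dvdnP[t ->] : (p * p * v %| \sum_(i < q.+2) 'C(p, i.+2) * v ^ i.+2)%N.
    by exists t; rewrite mulnC.
  apply: dvdn_sum => i _; have := ltn_ord i; rewrite ltnS leq_eqVlt => /orP[/eqP iE|lt_iq].
    have -> : (v ^ i.+2 = v ^ q * (v * v * v))%N by rewrite iE !expnS; lia.
    by rewrite dvdn_mull // dvdn_mull // !dvdn_mul.
  rewrite -mulnA dvdn_mul ?prime_dvd_bin //; first by lia.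
  by rewrite !expnS mulnA dvdn_mulr // dvdn_mul.
exists (1 + p * t)%N; first by rewrite dvdn_addl ?dvdn_mulr // dvdn1; lia.
rewrite expnDn; subst p; rewrite big_ord_recl big_ord_recl /=.
rewrite /bump /= !exp1n bin0 bin1 expn0 expn1 !mul1n.
under eq_bigr do rewrite /= !add1n exp1n mul1n.
by rewrite tE; move: (q.+3) => r; nia.
Qed.

Lemma ndvd_gt0 d k : ~~ (d %| k) -> 0 < k.
Proof. by case: k; rewrite ?dvdn0. Qed.

(** * Basic sets of generators as orbits of multipliers *)

Section Cyclotomic.
Variables (gT gT' : finGroupType) (e : gT -> gT' -> bool).
Hypotheses (cG : abelian [set: gT]) (cG' : abelian [set: gT']).
Hypothesis se : schur_rel e.

Local Notation blk := (schur_blk e).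
Local Notation im := (schur_im e).
Local Notation aset := (schur_aset e).

Variable p : nat.
Hypotheses (p_pr : prime p) (pG : p.-group [set: gT]).

Lemma pgroup_srel : p.-group [set: gT'].
Proof. by move: pG; rewrite /pgroup !cardsT (card_srel se). Qed.

Section TrivialRadical.
Variable x : gT.
Hypotheses (aH : aset <[x]>) (gens : forall y, y \in blk x -> <[y]> = <[x]>).
Hypotheses (rad1 : srad (blk x) = 1) (x1 : x != 1).

Lemma blk_coprime k : x ^+ k \in blk x -> ~~ (p %| k).
Proof.
move=> /gens kx; apply: contra (cycle_expp_proper p_pr pG x1) => /dvdnP[m km].
by rewrite -cycle_subG -kx km mulnC expgM cycle_subG mem_cycle.
Qed.

Lemma blk_stab k y : x ^+ k \in blk x -> y \in blk x -> y ^+ k \in blk x.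
Proof.
move=> kx yx; rewrite -(blk_eq se kx).
by rewrite (blk_expgE cG cG' se p_pr pG) ?blk_coprime.
Qed.

Lemma blk_stabX k i : x ^+ k \in blk x -> x ^+ (k ^ i)%N \in blk x.
Proof.
move=> kx; elim: i => [|i IHi]; first by rewrite expn0 expg1 blk_refl.
by rewrite expnSr expgM; apply: blk_stab.
Qed.

Lemma p_dvd_lmod v : lmod p %| v -> p %| v.
Proof. by rewrite /lmod; case: eqP => [->|//]; apply: dvdn_trans. Qed.

(* An element x * z of blk x would, after raising to p-th powers, yield one
   with z of order p, and then z would lie in the radical. *)
Lemma blk_lmod_aux j v : lmod p %| v -> x ^+ (v * p ^ j)%N = 1 ->
  x ^+ v != 1 -> x ^+ (1 + v)%N \notin blk x.
Proof.
elim: j v => [|j IHj] v lv vj vN1; first by rewrite expn0 muln1 in vj; rewrite vj eqxx in vN1.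
apply/negP => kx; have pv := p_dvd_lmod lv.
case: (eqVneq (x ^+ (v * p)%N) 1) => [zp|zp].
  (* Here z = x ^+ v has order p and p divides v, so the powers of the multiplier 1 + v translate x
     by the powers of z. *)
  have xz i : x ^+ ((1 + v) ^ i)%N = x ^+ (1 + v * i)%N.
    elim: i => [|i IHi]; first by rewrite muln0 addn0 expn0.
    have [c vE] := dvdnP pv.
    have -> : ((1 + v) ^ i.+1 = (1 + v) ^ i * (1 + v))%N by rewrite expnSr.
    rewrite expgM IHi -expgM.
    have -> : ((1 + v * i) * (1 + v) = 1 + v * i.+1 + v * p * (c * i))%N by nia.
    by rewrite expgD [x ^+ (v * p * _)%N]expgM zp expg1n mulg1.
  have : x ^+ v \in srad (blk x).
    apply: sradI => y yx; have [l pl yl] := cycle_eq_expg p_pr pG (gens yx).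
    have [n [_ _ powK]] := expg_coprime_inv (coprime_pgroup p_pr pG pl) (ndvd_gt0 pl).
    have -> : y * x ^+ v = (x ^+ (1 + v * n)%N) ^+ l.
      rewrite -expgM mulnDl mul1n expgD -yl; congr (_ * _).
      by rewrite -mulnA [(n * l)%N]mulnC expgM powK.
    by apply: blk_stab; rewrite -?yl // -xz blk_stabX.
  by rewrite rad1 inE (negbTE vN1).
(* Otherwise use the multiplier (1 + v) ^ p = 1 + p * v * w: as w is prime to p, its displacement is
   still nontrivial, and it is killed by a smaller power of p. *)
have [w pw pvw] := expn_1D_prime p_pr lv.
have := blk_stabX p kx; rewrite pvw; apply/negP; apply: IHj.
- by rewrite dvdn_mulr ?dvdn_mull.
- have -> : (p * v * w * p ^ j = v * p ^ j.+1 * w)%N by rewrite expnS; lia.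
  by rewrite expgM vj expg1n.
rewrite [(p * v)%N]mulnC expgM; apply: contra zp => /eqP zw.
have [n [_ _ powK]] := expg_coprime_inv (coprime_pgroup p_pr pG pw) (ndvd_gt0 pw).
by rewrite -(powK gT erefl (x ^+ (v * p)%N)) expgM zw expg1n.
Qed.

Lemma blk_lmod k : x ^+ k \in blk x -> k = 1 %[mod lmod p] -> x ^+ k = x.
Proof.
have [n xn] := order_pgroup pG x.
move=> kx /eqP; case: k kx => [|v] kx.
  by rewrite mod0n eq_sym /lmod => /dvdn_leq; have := prime_gt1 p_pr; case: eqP => // _; lia.
rewrite -add1n -{2}[1%N]addn0 eqn_modDl mod0n => lv.
apply/eqP; apply: contraTT kx => xv; rewrite -add1n; apply: (@blk_lmod_aux n) => //.
  by rewrite -xn mulnC expgM expg_order expg1n.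
by apply: contraNneq xv => xv; rewrite expgS xv mulg1.
Qed.

Lemma srel_blk_expg k y' : x ^+ k \in blk x -> e x y' -> e x (y' ^+ k).
Proof.
move=> kx exy'; have co_k := coprime_pgroup p_pr pG (blk_coprime kx).
have ekk := srel_expg cG cG' se co_k exy'.
by move: kx; rewrite (mem_blk se _ exy') => eky'; apply: (srel_difun se) exy' eky' ekk.
Qed.

Section Modulus.
(** [M] is later taken to be [p] in the first case of [blk_dichotomy] and [lmod p] in the second.
    The smaller [M], the more exponents j with M * p ^ j dividing the order, for which roots can be
    counted. *)
Variable M : nat.
Hypothesis (HM : forall k, x ^+ k \in blk x -> k = 1 %[mod M] -> x ^+ k = x).

Lemma expg_eq_mod (y : gT) q a b : #[y] = #[x] -> 0 < q -> (M * q %| #[x])%N ->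
  y ^+ (a * q)%N = y ^+ (b * q)%N -> a = b %[mod M].
Proof.
move=> yx q_gt0 Mq /eqP; rewrite eq_expg_mod_order yx => /eqP.
move/(congr1 (modn^~ (M * q)%N)); rewrite !modn_dvdm // -!muln_modl.
by move/eqP; rewrite eqn_pmul2r // => /eqP.
Qed.

(** Two exponents giving the same p ^ j-th power of x agree modulo [M], so [HM] makes x the only
    root in its basic set. The count 1 then transfers modulo p to the image and yields a root
    there. *)
Lemma card_blk_pow j : (M * p ^ j %| #[x])%N ->
  #|[set y in blk x | y ^+ (p ^ j)%N == x ^+ (p ^ j)%N]| = 1%N.
Proof.
move=> Mq; rewrite -(cards1 x); congr #|pred_of_set _|; apply/setP => y.
rewrite [LHS]in_set in_set1; apply/andP/eqP => [[yx yq]|->]; last by rewrite blk_refl.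
have [k _ yk] := cycle_eq_expg p_pr pG (gens yx).
rewrite yk; apply: HM; first by rewrite -yk.
apply: (@expg_eq_mod x (p ^ j)) => //; first by rewrite expn_gt0 prime_gt0.
by rewrite mul1n expgM -yk; apply/eqP.
Qed.

Lemma card_im_pow j g' : (M * p ^ j %| #[x])%N -> e (x ^+ (p ^ j)%N) g' ->
  #|[set y' in im x | y' ^+ (p ^ j)%N == g']| = 1 %[mod p].
Proof.
move=> Mq /(csets_pow_card cG cG' se j p_pr (csets_blk se x)) <-.
by rewrite card_blk_pow.
Qed.

Lemma ex_im_pow j g' : (M * p ^ j %| #[x])%N -> e (x ^+ (p ^ j)%N) g' ->
  exists2 y', e x y' & y' ^+ (p ^ j)%N = g'.
Proof.
move=> Mq /(card_im_pow Mq).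
case: (set_0Vmem [set y' in im x | y' ^+ (p ^ j)%N == g']) => [->|[y']].
  by rewrite cards0 mod0n modn_small ?prime_gt1.
by rewrite !inE => /andP[exy' /eqP yg] _; exists y'.
Qed.

End Modulus.

(** Only p = 2 can fail the first case. By [blk_lmod] the multipliers are then determined modulo 4,
    so there is exactly one nontrivial one, congruent to 3. Order 2 leaves no second generator, and
    for order 4 the set of x and x ^+ 3 would have x ^+ 2 in its radical. *)
Lemma blk_dichotomy :
  (forall k, x ^+ k \in blk x -> k = 1 %[mod p] -> x ^+ k = x) \/
  [/\ p = 2, 8 %| #[x] & exists k, [/\ k = 3 %[mod 4], x ^+ k \in blk x,
    x ^+ k != x & blk x = [set x; x ^+ k]]].
Proof.
case: (eqVneq p 2) => [p2|pN2]; last first.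
  by left=> k kx; have := blk_lmod kx; rewrite /lmod (negbTE pN2).
have lmod4 : lmod p = 4 by rewrite /lmod p2.
case: (boolP [exists y in blk x, y != x]) => [/exists_inP[y yx yNx]|]; last first.
  rewrite negb_exists_in => /forall_inP all_x; left=> k /all_x.
  by rewrite negbK => /eqP.
right; have [k _ yk] := cycle_eq_expg p_pr pG (gens yx).
have mod4 m : x ^+ m \in blk x -> m = 1 %[mod 4] \/ m = 3 %[mod 4].
  by move/blk_coprime; rewrite p2 => m2; lia.
have id1 m : x ^+ m \in blk x -> m = 1 %[mod 4] -> x ^+ m = x.
  by rewrite -lmod4; apply: blk_lmod.
rewrite yk in yx yNx.
have k3 : k = 3 %[mod 4] by case: (mod4 k yx) => // /(id1 k yx) kx; rewrite kx eqxx in yNx.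
have kk : x ^+ (k * k)%N = x.
  by apply: id1; [rewrite expgM blk_stab | rewrite -modnMm k3].
have bE : blk x = [set x; x ^+ k].
  apply/setP => u; rewrite in_set2; apply/idP/orP => [ux|[]/eqP-> //]; last exact: blk_refl.
  have [m _ um] := cycle_eq_expg p_pr pG (gens ux); rewrite um in ux *.
  case: (mod4 m ux) => m3; first by left; rewrite (id1 m).
  right; have mk : x ^+ (m * k)%N = x.
    by apply: id1; [rewrite expgM blk_stab | rewrite -modnMm k3 m3].
  by rewrite -{1}kk -expgM mulnAC [(k * m)%N]mulnC expgM mk.
split=> //; last by exists k.
have [n xn] := order_pgroup pG x; rewrite p2 in xn.
case: n xn => [|[|[|n]]] xn; rewrite xn; last by rewrite !expnS !mulnA dvdn_mulr.
- by move: xn => /eqP; rewrite order_eq1 (negbTE x1).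
- case/eqP: yNx; apply/eqP; rewrite -{2}[x]expg1 eq_expg_mod_order xn.
  by apply/eqP; lia.
suff : x ^+ 2 \in srad (blk x).
  by rewrite rad1 inE -order_dvdn xn.
have kx3 : x ^+ k = x ^+ 3 by apply/eqP; rewrite eq_expg_mod_order xn; apply/eqP.
apply: sradI => u; rewrite bE kx3 !in_set2 => /orP[]/eqP->.
  by rewrite -expgS eqxx orbT.
rewrite -expgD -{2}[x]expg1 eq_expg_mod_order xn.
by [].
Qed.

Lemma im_order_dvd x' : e x x' -> #[x'] %| #[x].
Proof.
move=> exx'; have [H' HH'] := aset_group_csets se aH.
have x'H' : x' \in H' by rewrite -(HH' _ _ exx') cycle_id.
by rewrite orderE (orderE x) (csets_card se HH') cardSg ?cycle_subG.
Qed.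

(** In the first case of [blk_dichotomy] some linked y' is a root of a nontrivial g', at the largest
    power of p below the order. In the second case, root counting stops one power of 2 earlier. If
    no linked element had full order, a root y' and y' ^+ k would be two distinct roots and fill
    [im x], which has two elements; but the number of roots is odd. *)
Lemma im_ex_order : exists2 x', e x x' & #[x'] = #[x].
Proof.
have full n y' : #[x] = (p ^ n.+1)%N -> e x y' -> y' ^+ (p ^ n)%N != 1 -> #[y'] = #[x].
  move=> xn exy' yn; have [m ym] := order_pgroup pgroup_srel y'.
  have := im_order_dvd exy'; rewrite ym xn dvdn_Pexp2l ?prime_gt1 // => m_le.
  congr (_ ^ _)%N; apply/eqP; rewrite eqn_leq m_le /= ltnNge.
  apply: contra yn => m_le_n; rewrite -order_dvdn ym dvdn_exp2l //.
have srel_N1 g g' : e g g' -> g != 1 -> g' != 1.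
  by move=> egg'; rewrite (srel_one se egg').
case: blk_dichotomy => [HM | [p2 N8 [k [k3 kx xk bE]]]].
  have [[|n] xn] := order_pgroup pG x.
    by move: xn => /eqP; rewrite order_eq1 (negbTE x1).
  have [g' eg'] := srel_total se (x ^+ (p ^ n)%N).
  have pN : (p * p ^ n %| #[x])%N by rewrite xn expnS.
  have [y' exy' yn] := ex_im_pow HM pN eg'.
  exists y' => //; apply: (full n) => //; rewrite yn; apply: srel_N1 eg' _.
  by rewrite -order_dvdn xn dvdn_Pexp2l ?prime_gt1 ?ltnn.
have [n xn] : exists n, #[x] = (p ^ n.+3)%N.
  have [[|[|[|n]]] xn] := order_pgroup pG x; last by exists n.
  - by rewrite xn p2 in N8.
  - by rewrite xn p2 in N8.
  by rewrite xn p2 in N8.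
have lmod4 : lmod p = 4 by rewrite /lmod p2.
have pN : (lmod p * p ^ n.+1 %| #[x])%N by rewrite xn lmod4 p2 !expnS !mulnA.
have [g' eg'] := srel_total se (x ^+ (p ^ n.+1)%N).
have g'N1 : g' != 1.
  by apply: srel_N1 eg' _; rewrite -order_dvdn xn dvdn_Pexp2l ?prime_gt1 // -ltnNge.
pose F := [set y' in im x | y' ^+ (p ^ n.+1)%N == g'].
have F_odd : #|F| = 1 %[mod p] := card_im_pow blk_lmod pN eg'.
have card_im : #|im x| = 2.
  by rewrite -(csets_card se (csets_blk se x)) bE cards2 eq_sym xk.
case: (boolP [exists y' in im x, y' ^+ (p ^ n.+2)%N != 1]) => [/exists_inP[y']|].
  by rewrite inE => exy' yn; exists y' => //; apply: full yn.
rewrite negb_exists_in => /forall_inP all1.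
have [y' yF] : exists y', y' \in F.
  apply/set0Pn; apply: contra_eq_neq F_odd => ->.
  by rewrite cards0 mod0n modn_small ?prime_gt1.
have [exy' yq] : e x y' /\ y' ^+ (p ^ n.+1)%N = g' by move: yF; rewrite !inE => /andP[? /eqP].
have yqq : y' ^+ (p ^ n.+2)%N = 1 by apply/eqP; rewrite -[_ == _]negbK all1 ?inE.
have [c [kE c_odd]] : exists c, k = (1 + 2 * c)%N /\ odd c by exists k./2; clear -k3; split; lia.
have ky : y' ^+ k \in F.
  rewrite in_set inE srel_blk_expg //= -expgM.
  have ->
    : (k * p ^ n.+1 = p ^ n.+1 + p ^ n.+2 * c)%N by rewrite kE mulnDl mul1n [X in (_ + X * c)%N]expnS p2 mulnAC.
  by rewrite expgD yq expgM yqq expg1n mulg1.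
have kNy : y' ^+ k != y'.
  apply: contra g'N1 => /eqP; rewrite kE expgD expg1 -{3}[y']mulg1 => /mulgI y2c.
  have pc : ~~ (p %| c) by rewrite p2 dvdn2 negbK.
  have [m [_ _ powK]] := expg_coprime_inv (coprime_pgroup p_pr pG pc) (ndvd_gt0 pc).
  have y2 : y' ^+ 2 = 1.
    by rewrite -(powK gT' (esym (card_srel se)) (y' ^+ 2)) expgM -[y' ^+ 2 ^+ c]expgM y2c expg1n.
  by rewrite -yq expnS {1}p2 expgM y2 expg1n.
have : [set y'; y' ^+ k] \subset F by apply/subsetP => u /set2P[]->.
move/subset_leq_card; rewrite cards2 eq_sym kNy /= => F2.
have : #|F| <= #|im x| by apply/subset_leq_card/subsetP => u; rewrite in_set => /andP[].
rewrite card_im => F2'; move: F_odd.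
have -> : #|F| = 2 by apply/eqP; rewrite eqn_leq F2 F2'.
by rewrite p2.
Qed.

(** The exponents stabilising [blk x] move a linked element of full order to #|blk x| distinct
    elements of the image, which therefore exhaust it. Being prime to p, they preserve the order. *)
Lemma im_cycle x' : e x x' ->
  #[x'] = #[x] /\ forall w', e x w' -> exists2 k, x ^+ k \in blk x & w' = x' ^+ k.
Proof.
have [y' exy' oy'] := im_ex_order.
have im_pow z' : e x z' -> #[z'] = #[x] ->
    forall w', e x w' -> exists2 k, x ^+ k \in blk x & w' = z' ^+ k.
  move=> exz' oz'; pose K := [set k : 'I_#[x] | x ^+ k \in blk x].
  have inj (hT : finGroupType) (u : hT) : #[u] = #[x] ->
      injective (fun k : 'I_#[x] => u ^+ k).
    move=> ou i j /eqP; rewrite eq_expg_mod_order ou !modn_small //.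
    by move/eqP/val_inj.
  have imE : [set z' ^+ (k : 'I_#[x]) | k in K] = im x.
    apply/eqP; rewrite eqEcard; apply/andP; split.
      apply/subsetP => _ /imsetP[k + ->]; rewrite in_set => kx.
      by rewrite inE srel_blk_expg.
    rewrite (card_imset _ (inj _ _ oz')) -(card_imset _ (inj _ x erefl)).
    rewrite -(csets_card se (csets_blk se x)); apply/subset_leq_card/subsetP => u ux.
    have /cyclePmin[k k_lt uk] : u \in <[x]> by rewrite -(gens ux) cycle_id.
    by apply/imsetP; exists (Ordinal k_lt); rewrite // in_set /= -uk.
  move=> w' exw'; have : w' \in im x by rewrite inE.
  by rewrite -imE => /imsetP[k]; rewrite in_set; exists k.
move=> exx'; suff ox' : #[x'] = #[x] by split=> //; apply: im_pow.
have [k kx ->] := im_pow y' exy' oy' x' exx'.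
rewrite -oy' (orderE y') -(cycle_expg_coprime p_pr pgroup_srel y' (blk_coprime kx)).
exact: orderE.
Qed.

(* Applying e to x ^+ (1 + q) = x ^+ q * x. *)
Lemma srel_pow_factor j x' : 0 < j -> e x x' ->
  exists2 y', e (x ^+ (p ^ j)%N) y'
  & exists2 a, x ^+ a \in blk x & x' ^+ (1 + p ^ j)%N = y' * x' ^+ a.
Proof.
move=> j_gt0 exx'; set q := (p ^ j)%N.
have pq : ~~ (p %| 1 + q).
  by rewrite dvdn_addl ?dvdn1 ?neq_ltn ?prime_gt1 ?orbT // /q -(prednK j_gt0) expnS dvdn_mulr.
have := csets_mul se (csets_blk se (x ^+ q)) (csets_blk se x).
move/(_ _ _ (srel_expg cG cG' se (coprime_pgroup p_pr pG pq) exx')).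
have -> : x ^+ (1 + q)%N \in blk (x ^+ q) * blk x.
  by rewrite addnC expgD expg1 mem_mulg ?blk_refl.
move/esym/mulsgP => [y' w']; rewrite !inE => ey' /(im_cycle exx').2[a ax ->] ->.
by exists y' => //; exists a.
Qed.

(** Put q = p ^ j. In x' ^+ (1 + q) = y' * x' ^+ a, the root count gives y' = x' ^+ (b * q) for a
    stabilising exponent b. As b * q and q agree modulo [M], comparing exponents gives a = 1 modulo
    [M], so a fixes x by [HM], and y' is x' ^+ q. *)
Lemma srel_pow_mod M j x' :
    (forall k, x ^+ k \in blk x -> k = 1 %[mod M] -> x ^+ k = x) ->
    (M * p ^ j %| #[x])%N ->
    (forall b, ~~ (p %| b) -> b * p ^ j = p ^ j %[mod M])%N ->
  0 < j -> e x x' -> e (x ^+ (p ^ j)%N) (x' ^+ (p ^ j)%N).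
Proof.
move=> HM Mq Mb j_gt0 exx'; have [ox' imx] := im_cycle exx'.
have [y' ey' [a ax x'E]] := srel_pow_factor j_gt0 exx'.
have [w' /imx[b bx ->] yE] := ex_im_pow HM Mq ey'.
have MN : M %| #[x] by apply: dvdn_trans Mq; apply: dvdn_mulr.
suff xa : x ^+ a = x.
  move: x'E; rewrite (_ : x' ^+ a = x') 1?addnC ?expgD ?expg1; first by move/mulIg->.
  apply/eqP; rewrite -{2}[x']expg1 eq_expg_mod_order ox' -eq_expg_mod_order expg1.
  exact/eqP.
apply: HM => //; move/eqP: x'E; rewrite -yE -expgM -expgD eq_expg_mod_order ox'.
move/eqP/(congr1 (modn^~ M)); rewrite !modn_dvdm // -[in RHS]modnDml Mb ?blk_coprime //.
by rewrite modnDml addnC => /eqP; rewrite eqn_modDl => /eqP.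
Qed.

Lemma srel_pow j x' : (p * p ^ j %| #[x])%N -> e x x' ->
  e (x ^+ (p ^ j)%N) (x' ^+ (p ^ j)%N).
Proof.
case: j => [|j] pq exx'; first by rewrite expn0 !expg1.
case: blk_dichotomy => [HM|[p2 N8 _]].
  apply: (@srel_pow_mod p) => // b _.
  by rewrite expnS mulnCA !modnMr.
have lmod4 : lmod p = 4 by rewrite /lmod p2.
have pow4 i : (lmod p * p ^ i.+1 %| #[x])%N -> e (x ^+ (p ^ i.+1)%N) (x' ^+ (p ^ i.+1)%N).
  move=> lq; apply: (srel_pow_mod (M := lmod p)) => //; first exact: blk_lmod.
  move=> b; rewrite lmod4 p2 dvdn2 negbK expnS => b_odd; clear -b_odd.
  have [c ->] : exists c, b = (1 + c * 2)%N by exists b./2; lia.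
  rewrite mulnDl mul1n -mulnA [(2 * (2 * _))%N]mulnA.
  by rewrite -modnDmr [X in (_ + X %% _)%N]mulnCA modnMr addn0.
have [/pow4 //|] := boolP (lmod p * p ^ j.+1 %| #[x])%N.
have [n xn] := order_pgroup pG x; rewrite xn lmod4 p2 -[4]/(2 ^ 2)%N -expnD.
rewrite dvdn_Pexp2l // -ltnNge => lt_nj.
have nE : n = j.+2.
  by move: pq; rewrite xn p2 -expnS dvdn_Pexp2l //; move: lt_nj; clear; lia.
case: j pq nE {lt_nj} => [|j] pq nE; first by move: N8; rewrite xn nE p2.
have ez : e (x ^+ (p ^ j.+1)%N) (x' ^+ (p ^ j.+1)%N).
  by apply: pow4; rewrite lmod4 xn nE p2 !expnS !mulnA.
have lq : (lmod p * p ^ j.+1 %| #[x])%N by rewrite lmod4 xn nE p2 !expnS !mulnA.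
have imz u' : e (x ^+ (p ^ j.+1)%N) u' -> exists2 b, odd b & u' = x' ^+ (b * p ^ j.+1)%N.
  move=> eu'; have [w' /(im_cycle exx').2[b bx ->] <-] := ex_im_pow blk_lmod lq eu'.
  by exists b; rewrite ?expgM //; have := blk_coprime bx; rewrite p2 dvdn2 negbK.
(* The remaining power of x is the involution of [<[x]>], the square of the previous power. Its
   image y' is a product of two odd powers of x' ^+ (p ^ j.+1), so a power of the involution of
   [<[x']>]; and it is not 1. *)
have [y' ey'] := srel_total se (x ^+ (p ^ j.+2)%N).
have pj : (p ^ j.+2 = p ^ j.+1 + p ^ j.+1)%N by rewrite expnS {1}p2 mul2n addnn.
have := csets_mul se (csets_blk se (x ^+ (p ^ j.+1)%N)) (csets_blk se (x ^+ (p ^ j.+1)%N)) ey'.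
rewrite {1}pj expgD mem_mulg ?blk_refl // => /esym/mulsgP[u' v'].
rewrite !inE => /imz[b b_odd ->] /imz[c c_odd ->]; rewrite -expgD -mulnDl.
have [d ->] : exists d, (b + c)%N = (d * 2)%N.
  by exists (b + c)./2; clear -b_odd c_odd; lia.
rewrite -mulnA -{1}p2 -expnS mulnC expgM -(odd_double_half d) expgD -mul2n expgM.
have -> : x' ^+ (p ^ j.+2)%N ^+ 2 = 1.
  by rewrite -expgM -p2 -expnSr -nE -xn -(im_cycle exx').1 expg_order.
rewrite expg1n mulg1; case: (odd d) => yE; first by rewrite /= expg1 in yE; rewrite -p2 -yE.
have := srel_one se ey'; rewrite yE eqxx -order_dvdn xn nE dvdn_Pexp2l ?prime_gt1 //.
by rewrite ltnn.
Qed.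

Lemma srel_cycle x' m : e x x' -> e (x ^+ m) (x' ^+ m).
Proof.
move=> exx'; have [->|m_gt0] := posnP m; first by rewrite !expg0 srel11.
have [m' pm' ->] := pfactor_coprime p_pr m_gt0.
set j := logn p m.
have co_m' : coprime #|gT| m'.
  by apply: (coprime_pgroup p_pr pG); rewrite -prime_coprime.
rewrite mulnC !expgM; apply: (srel_expg cG cG' se) => //.
have [n xn] := order_pgroup pG x; have [lt_jn|le_nj] := ltnP j n.
  by apply: srel_pow => //; rewrite xn -expnS dvdn_exp2l.
have xj : x ^+ (p ^ j)%N = 1 by apply/eqP; rewrite -order_dvdn xn dvdn_exp2l.
have xj' : x' ^+ (p ^ j)%N = 1.
  by apply/eqP; rewrite -order_dvdn (im_cycle exx').1 xn dvdn_exp2l.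
by rewrite xj xj' (srel11 se).
Qed.

End TrivialRadical.

End Cyclotomic.

Section CyclotomicRadical.
Variables (gT gT' : finGroupType) (e : gT -> gT' -> bool).
Hypotheses (cG : abelian [set: gT]) (cG' : abelian [set: gT']).
Hypothesis se : schur_rel e.

Local Notation csets := (schur_csets e).
Local Notation blk := (schur_blk e).
Local Notation aset := (schur_aset e).

Variable p : nat.
Hypotheses (p_pr : prime p) (pG : p.-group [set: gT]).

Lemma modrel_cycle x x' m : aset <[x]> -> (forall y, y \in blk x -> <[y]> = <[x]>) ->
  e x x' -> modrel e (srad (blk x)) (x ^+ m) (x' ^+ m).
Proof.
move=> aH gens exx'.
have [x1|x1] := eqVneq x 1.
  move: exx'; rewrite x1 => /(srel1P se)->; rewrite !expg1n.
  by apply/exists_inP; exists 1; rewrite ?group1 // mulg1 srel11.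
pose D := srad_group (blk x); have DE : D :=: srad (blk x) by [].
have [D' DD'] : exists D' : {group gT'}, csets D D'.
  by apply: (aset_group_csets se); apply: (aset_srad cG cG' se) (aset_blk se x).
have Dx : D \subset <[x]> := srad_sub_cycle se aH.
have cQ := abelian_coset_setT cG D; have cQ' := abelian_coset_setT cG' D'.
have sq := srel_quotient cG cG' se DD'.
rewrite -[srad _]/(D : {set gT}) -(qrelE cG cG' se DD') (cosetXT cG) (cosetXT cG').
apply: (srel_cycle cQ cQ' sq p_pr (pgroup_coset pG D)).
- by rewrite (aset_cycle_coset cG cG' se DD').
- move=> u; rewrite -[u]coset_reprK (mem_blk_coset_srad cG cG' se DD' DE) => /gens ux.
  by rewrite -!quotient_cycle ?mem_norm_abelian // ux.
- exact: (srad_coset cG cG' se DD' DE).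
- rewrite (coset_eq1 cG); apply: contra x1 => xD.
  have : x * x^-1 \in blk x by rewrite mem_srad ?groupV ?blk_refl.
  by rewrite mulgV (blk_sym se) (blk1 se) inE.
exact: (srel_coset cG cG' se DD').
Qed.

End CyclotomicRadical.

(** * Construction of the combinatorial isomorphism *)

Section Gluing.
Variables (gT gT' : finGroupType) (e : gT -> gT' -> bool).
Hypotheses (cG : abelian [set: gT]) (cG' : abelian [set: gT']).
Hypothesis se : schur_rel e.

Local Notation csets := (schur_csets e).
Local Notation blk := (schur_blk e).
Local Notation im := (schur_im e).

Variable p : nat.
Hypotheses (p_pr : prime p) (pG : p.-group [set: gT]).

Definition dlog (x g : gT) : nat :=
  if [pick k : 'I_#[x] | x ^+ k == g] is Some k then k else 0.

Lemma dlogP x g : g \in <[x]> -> x ^+ dlog x g = g /\ dlog x g < #[x].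
Proof.
rewrite /dlog => /cyclePmin[k k_lt ->]; case: pickP => [i /eqP // | /(_ (Ordinal k_lt))].
by rewrite /= eqxx.
Qed.

Lemma dlogX x m : dlog x (x ^+ m) = m %% #[x].
Proof.
have [/eqP + d_lt] := dlogP (mem_cycle x m).
by rewrite eq_expg_mod_order modn_small // => /eqP.
Qed.

Section Glue.
Variables (x : gT) (b : nat) (rho : nat -> gT') (f : gT -> gT').
Hypotheses (b_gt0 : 0 < b) (bx : b %| #[x]).

(** On the coset of x ^+ i with i < b, this is [f] translated by [rho i]. The translating elements
    are powers of x' in [lift_step] and coset representatives in [lift_wreath]. *)
Definition glue (g : gT) : gT' :=
  rho (dlog x g %% b) * f ((x ^+ b) ^+ (dlog x g %/ b)%N).

(** Within a coset the common translation cancels from the quotient, so only pairs from different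
    cosets require an argument. *)
Lemma glue_srel :
  {in <[x ^+ b]> &, forall g h, e (g * h^-1) (f g * (f h)^-1)} ->
  {in <[x]> &, forall g h, g * h^-1 \notin <[x ^+ b]> ->
     e (g * h^-1) (glue g * (glue h)^-1)} ->
  {in <[x]> &, forall g h, e (g * h^-1) (glue g * (glue h)^-1)}.
Proof.
move=> f_e out g h gx hx; have [ghb|] := boolP (g * h^-1 \in <[x ^+ b]>); last exact: out.
have [gE g_lt] := dlogP gx; have [hE h_lt] := dlogP hx.
have kl : dlog x g = dlog x h %[mod b].
  have /cycleP[i gh] := ghb.
  have : x ^+ dlog x g = x ^+ (b * i + dlog x h)%N.
    by rewrite expgD expgM -gh gE hE mulgKV.
  move/eqP; rewrite eq_expg_mod_order => /eqP/(congr1 (modn^~ b)).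
  by rewrite !modn_dvdm // mulnC modnMDl.
have split_exp y : y \in <[x]> -> y = x ^+ (dlog x y %% b) * (x ^+ b) ^+ (dlog x y %/ b)%N.
  by move=> /dlogP[yE _]; rewrite -expgM -expgD addnC mulnC -divn_eq.
have cancel_l (hT : finGroupType) (cH : abelian [set: hT]) (r a c : hT) :
    (r * a) * (r * c)^-1 = a * c^-1.
  by rewrite invMg mulgA (abelian_setT_mulC cH r a) -!mulgA (abelian_setT_mulC cH c^-1) mulKVg.
rewrite {1}(split_exp g gx) {1}(split_exp h hx) /glue kl (cancel_l _ cG) (cancel_l _ cG').
by apply: f_e; apply: mem_cycle.
Qed.

End Glue.

Lemma cycle_subgroup x (D : {group gT}) : D \subset <[x]> ->
  exists b, [/\ 0 < b, b %| #[x], D :=: <[x ^+ b]> & #[x] = (b * #|D|)%N].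
Proof.
move=> Dx; have Dn : #|D| %| #[x] by rewrite orderE cardSg.
exists (#[x] %/ #|D|).
have b_gt0 : 0 < #[x] %/ #|D| by rewrite divn_gt0 ?cardG_gt0 // dvdn_leq ?order_gt0.
have bx : #[x] %/ #|D| %| #[x] by apply: dvdn_div.
split=> //; last by rewrite divnK.
apply/eqP; rewrite (eq_subG_cyclic (cycle_cyclic x)) ?cycleX // -orderE orderXdiv //.
by rewrite divnA // mulKn.
Qed.

Lemma csets_sub (L D : {group gT}) (L' D' : {group gT'}) :
  csets L L' -> csets D D' -> D \subset L -> D' \subset L'.
Proof.
move=> LL' DD' DL; apply/subsetP => d' d'D; have [d edd'] := srel_surj se d'.
by rewrite -(LL' _ _ edd') (subsetP DL) // (DD' _ _ edd').
Qed.

Lemma modrel_mem (L : {group gT}) (L' : {group gT'}) y y' :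
  csets L L' -> modrel e L y y' -> (y \in L) = (y' \in L').
Proof.
by move=> LL' /exists_inP[l lL ell]; rewrite -(LL' _ _ ell) groupMr.
Qed.

Lemma modrel_srad (L : {group gT}) (L' : {group gT'}) y y' :
  csets L L' -> L \subset srad (blk y) -> modrel e L y y' -> e y y'.
Proof.
move=> LL' Ly /exists_inP[l lL eyl]; rewrite -(mem_blk se _ eyl).
by rewrite (blk_sym se) mem_srad ?(blk_refl se) // (subsetP Ly).
Qed.

(** The hypothesis covers only natural exponents; inverses become such powers because both cosets
    have order dividing [#[x]]. *)
Lemma qrel_coset_expg (L : {group gT}) (L' : {group gT'}) x x' k l :
  csets L L' -> (forall m, modrel e L (x ^+ m) (x' ^+ m)) ->
  qrel e (coset L x ^+ k * (coset L x ^+ l)^-1) (coset L' x' ^+ k * (coset L' x' ^+ l)^-1).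
Proof.
move=> LL' xx'; have N1 : coset L' x' ^+ #[x] = 1.
  apply/eqP; rewrite -(cosetXT cG') (coset_eq1 cG') -(modrel_mem LL' (xx' _)).
  by rewrite expg_order group1.
have N1x : coset L x ^+ #[x] = 1.
  by apply/eqP; rewrite -(cosetXT cG) (coset_eq1 cG) expg_order group1.
have inv (hT : finGroupType) (u : hT) : u ^+ #[x] = 1 -> (u ^+ l)^-1 = u ^+ (#[x].-1 * l)%N.
  move=> uN; apply/eqP; rewrite eq_invg_mul -expgD -mulSn prednK ?order_gt0 //.
  by rewrite expgM uN expg1n.
rewrite !inv // -!expgD -(cosetXT cG) -(cosetXT cG') (qrelE cG cG' se LL').
exact: xx'.
Qed.

(* As the basic sets outside <[x ^+ b]> are unions of L-cosets, translates of f
   by the powers of x' glue together. *)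
Lemma lift_step x b (L : {group gT}) (L' : {group gT'}) x' f :
  csets L L' -> 0 < b -> b %| #[x] ->
  (forall y, y \in <[x]> -> y \notin <[x ^+ b]> -> L \subset srad (blk y)) ->
  (forall m, modrel e L (x ^+ m) (x' ^+ m)) ->
  {in <[x ^+ b]> &, forall g h, e (g * h^-1) (f g * (f h)^-1)} ->
  (forall m, ((x' ^+ b) ^+ m)^-1 * f ((x ^+ b) ^+ m) \in L') ->
  exists f' : gT -> gT', {in <[x]> &, forall g h, e (g * h^-1) (f' g * (f' h)^-1)}
    /\ forall m, (x' ^+ m)^-1 * f' (x ^+ m) \in L'.
Proof.
move=> LL' b_gt0 bx out xx' f_e f_L; pose f' := glue x b (fun j => x' ^+ j) f.
(* Modulo L' the glued map is the prescribed isomorphism sending x to x', whatever [f] was on the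
   pieces. *)
have f'E g : g \in <[x]> -> coset L' (f' g) = coset L' x' ^+ dlog x g.
  move=> gx; rewrite /f' /glue (cosetMT cG').
  have := f_L (dlog x g %/ b); rewrite -(coset_eqE cG') => /eqP <-.
  by rewrite -(cosetMT cG') -expgM -expgD addnC mulnC -divn_eq (cosetXT cG').
exists f'; split=> [|m].
  apply: glue_srel => // g h gx hx ghb.
  apply: (modrel_srad LL'); first by apply: out => //; rewrite groupM ?groupV.
  rewrite -/f' -(qrelE cG cG' se LL') (cosetMT cG') (cosetMT cG) (cosetVT cG) (cosetVT cG').
  rewrite !f'E // -{1}(dlogP gx).1 -{1}(dlogP hx).1 !(cosetXT cG).
  exact: qrel_coset_expg.
rewrite -(coset_eqE cG') f'E ?mem_cycle // dlogX (cosetXT cG') {1}(divn_eq m #[x]) expgD mulnC expgM.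
have -> : coset L' x' ^+ #[x] = 1.
  apply/eqP; rewrite -(cosetXT cG') (coset_eq1 cG') -(modrel_mem LL' (xx' _)).
  by rewrite expg_order group1.
by rewrite expg1n mul1g.
Qed.

(* Here blk x is the whole complement of D in <[x]>, so any bijection between
   the cosets of D and of D' may be used. *)
Lemma lift_wreath x b (D : {group gT}) (D' H' : {group gT'}) f :
  csets D D' -> csets <[x]> H' -> 0 < b -> b %| #[x] -> D :=: <[x ^+ b]> ->
  #[x] = (b * #|D|)%N -> D \subset <[x]> -> blk x = <[x]> :\: D ->
  {in D &, forall g h, e (g * h^-1) (f g * (f h)^-1)} ->
  {in D, forall g, f g \in D'} ->
  exists f' : gT -> gT', {in <[x]> &, forall g h, e (g * h^-1) (f' g * (f' h)^-1)}
    /\ {in <[x]>, forall g, f' g \in H'}.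
Proof.
move=> DD' HH' b_gt0 bx DE xE Dx blkE f_e f_D.
have D'H' : D' \subset H' := csets_sub HH' DD' Dx.
pose cs := enum (H' / D')%g; pose rho j := repr (nth 1 cs j).
have sz : size cs = b.
  rewrite -cardE card_quotient; last first.
    by apply/subsetP => u _; apply: mem_norm_abelian.
  rewrite -divgS // -(csets_card se HH') -(csets_card se DD') -orderE xE.
  by rewrite mulnK // cardG_gt0.
have rho_coset j : coset D' (rho j) = nth 1 cs j by rewrite /rho coset_reprK.
have rhoH j : j < b -> rho j \in H'.
  move=> j_lt; have : coset D' (rho j) \in (H' / D')%g.
    by rewrite rho_coset -mem_enum mem_nth // sz.
  case/morphimP => h _ hH' /eqP; rewrite eq_sym (coset_eqE cG') => rh.
  by rewrite -(mulKVg h (rho j)) groupM // (subsetP D'H').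
have rho_inj i j : i < b -> j < b -> coset D' (rho i) = coset D' (rho j) -> i = j.
  move=> i_lt j_lt; rewrite !rho_coset => /eqP.
  by rewrite nth_uniq ?sz ?enum_uniq // => /eqP.
pose f' := glue x b rho f.
have fb m : f ((x ^+ b) ^+ m) \in D' by rewrite f_D // DE mem_cycle.
have f'H : {in <[x]>, forall g, f' g \in H'}.
  by move=> g gx; rewrite groupM ?rhoH ?ltn_pmod // (subsetP D'H').
exists f'; split=> //; apply: glue_srel => //; first by rewrite -DE.
move=> g h gx hx; rewrite -DE => ghD; rewrite -/f'.
have ghx : g * h^-1 \in blk x by rewrite blkE inE ghD groupM ?groupV.
(* The image of the complement of D is the complement of D' in H', so it is enough that distinct
   cosets of D go to distinct cosets of D'. *)
suff : f' g * (f' h)^-1 \in im (g * h^-1) by rewrite inE.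
have blkgh := csets_blk se (g * h^-1); rewrite (blk_eq se ghx) blkE in blkgh.
have diffc : csets (<[x]> :\: D) (H' :\: D').
  by move=> y y' eyy'; rewrite !inE (HH' _ _ eyy') (DD' _ _ eyy').
rewrite (csets_inj se blkgh diffc) in_setD; apply/andP; split; last by rewrite groupM ?groupV ?f'H.
apply: contra ghD => ffD.
have /rho_inj kl : coset D' (rho (dlog x g %% b)) = coset D' (rho (dlog x h %% b)).
  have f'c k : k \in <[x]> -> coset D' (f' k) = coset D' (rho (dlog x k %% b)).
    by move=> kx;
      rewrite /f' /glue (cosetMT cG') (eqP (_ : coset D' (f _) == 1)) ?mulg1 // (coset_eq1 cG').
  rewrite -!f'c //; apply/eqP; rewrite eq_sym (coset_eqE cG').
  by rewrite (abelian_setT_mulC cG').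
have {kl} kl := kl (ltn_pmod _ b_gt0) (ltn_pmod _ b_gt0).
have xb k : k \in <[x]> -> coset D k = coset D x ^+ (dlog x k %% b).
  have ub : coset D x ^+ b = 1.
    by apply/eqP; rewrite -(cosetXT cG) (coset_eq1 cG) DE cycle_id.
  move=> kx; rewrite -{1}(dlogP kx).1 (cosetXT cG) {1}(divn_eq (dlog x k) b) expgD.
  by rewrite [(_ * b)%N]mulnC expgM ub expg1n mul1g.
by rewrite -(coset_eq1 cG) (cosetMT cG) (cosetVT cG) (xb g gx) (xb h hx) kl mulgV.
Qed.

End Gluing.

(** * Lifting isomorphisms of quotients by induction *)

Section Lifting.
Variables (gT gT' : finGroupType) (e : gT -> gT' -> bool).
Hypotheses (cG : abelian [set: gT]) (cG' : abelian [set: gT']).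
Hypothesis se : schur_rel e.

Local Notation csets := (schur_csets e).
Local Notation blk := (schur_blk e).
Local Notation aset := (schur_aset e).

Variable p : nat.
Hypotheses (p_pr : prime p) (pG : p.-group [set: gT]).

Lemma srad_blk_eq x y : <[y]> = <[x]> -> srad (blk x) \subset srad (blk y).
Proof.
move=> yx; have [k pk xk] := cycle_eq_expg p_pr pG (esym yx).
apply/subsetP => d dD; apply: sradI => u uy.
rewrite -(blk_expgE cG cG' se p_pr pG _ _ pk) -xk expgMn; last exact: abelian_setT_mulC.
by rewrite mem_srad ?groupX // xk (blk_expgE cG cG' se p_pr pG).
Qed.

Lemma blk_gens x : x != 1 -> aset <[x]> -> aset <[x ^+ p]> ->
  forall y, y \in blk x -> <[y]> = <[x]>.
Proof.
move=> x1 aH aM y yx.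
case: (mem_cycle_expp p_pr pG (subsetP (aset_subset_blk aH (cycle_id x)) y yx)) => // yp.
case/negP: (cycle_expp_proper p_pr pG x1).
by rewrite (subsetP (aset_subset_blk aM yp)) // (blk_sym se).
Qed.

Lemma schur_rel_lift x (L : {group gT}) (L' : {group gT'}) x' :
  aset <[x]> -> csets L L' -> L \subset <[x]> ->
  (forall m, modrel e L (x ^+ m) (x' ^+ m)) ->
  exists f : gT -> gT', {in <[x]> &, forall g h, e (g * h^-1) (f g * (f h)^-1)}
    /\ forall m, (x' ^+ m)^-1 * f (x ^+ m) \in L'.
Proof.
have [n] := ubnP #[x]; elim: n x L L' x' => // n IHn x L L' x' lt_xn aH LL' Lx xx'.
have [x1|x1] := eqVneq x 1.
  exists (fun=> 1); split=> [g h|m].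
    by rewrite x1 cycle1 => /set1P-> /set1P->; rewrite !invg1 !mulg1 srel11.
  by rewrite mulg1 groupV -(modrel_mem LL' (xx' m)) x1 expg1n group1.
have step b : 1 < b -> b %| #[x] -> aset <[x ^+ b]> ->
  forall (K : {group gT}) (K' : {group gT'}) z',
    csets K K' -> K \subset <[x ^+ b]> -> (forall m, modrel e K ((x ^+ b) ^+ m) (z' ^+ m)) ->
    exists f : gT -> gT', {in <[x ^+ b]> &, forall g h, e (g * h^-1) (f g * (f h)^-1)}
      /\ forall m, (z' ^+ m)^-1 * f ((x ^+ b) ^+ m) \in K'.
  move=> b_gt1 bx ab K K' z' KK' Kb zz'; apply: IHn zz' => //.
  by rewrite orderXdiv // (leq_trans (ltn_Pdiv b_gt1 (order_gt0 x))).
pose D := srad_group (blk x); have DE : D :=: srad (blk x) by [].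
have aD : aset D := aset_srad cG cG' se (aset_blk se x).
have [D' DD'] := aset_group_csets se aD.
have Dx : D \subset <[x]> := srad_sub_cycle se aH.
have [aM|naM] := boolP (aset <[x ^+ p]>).
  have gens := blk_gens x1 aH aM.
  have px : p %| #[x].
    have [[|m] xm] := order_pgroup pG x; last by rewrite xm expnS dvdn_mulr.
    by move: xm => /eqP; rewrite order_eq1 (negbTE x1).
  have Dxp : D \subset <[x ^+ p]> := srad_blk_expp se p_pr pG aH x1.
  (* All generators of [<[x]>] have basic sets with radical containing D, by [srad_blk_eq]. So for K
     inside D the basic sets outside [<[x ^+ p]>] are unions of K-cosets, and [lift_step]
     applies. *)
  have low (K : {group gT}) (K' : {group gT'}) z' : csets K K' -> K \subset D ->
      (forall m, modrel e K (x ^+ m) (z' ^+ m)) ->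
      exists f : gT -> gT', {in <[x]> &, forall g h, e (g * h^-1) (f g * (f h)^-1)}
        /\ forall m, (z' ^+ m)^-1 * f (x ^+ m) \in K'.
    move=> KK' KD zz'.
    have [||f [f_e f_K]] := step p (prime_gt1 p_pr) px aM K K' (z' ^+ p) KK'.
    - exact: subset_trans Dxp.
    - by move=> m; rewrite -!expgM.
    apply: (lift_step cG cG' se KK' (prime_gt0 p_pr) px _ zz' f_e f_K) => y yx yNp.
    apply: subset_trans KD _; apply: srad_blk_eq.
    by case: (mem_cycle_expp p_pr pG yx) => // yp; case/negP: yNp.
  have [LD|/negP LND] := boolP (L \subset D); first exact: low LL' LD xx'.
  have DL : D \subset L.
    rewrite -(cardSg_cyclic (cycle_cyclic x)) //; move: LND.
    rewrite -(cardSg_cyclic (cycle_cyclic x)) //.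
    have card_p (K : {group gT}) : exists i, #|K| = (p ^ i)%N.
      have : p.-group K by apply: pgroupS pG; apply: subsetT.
      by rewrite /pgroup; case/p_natP=> // i ->; exists i.
    have [i ->] := card_p L; have [j ->] := card_p D.
    by rewrite !dvdn_Pexp2l ?prime_gt1 // => /negP; rewrite -ltnNge => /ltnW.
  (* When L is larger than D, x' is linked to x only modulo L'. Correcting it by l' gives an element
     linked to x itself, so [modrel_cycle] provides an isomorphism modulo D that refines the given
     one, and its lift serves for L as well. *)
  have [l' l'L exl] : exists2 l', l' \in L' & e x (x' * l').
    by have := xx' 1%N; rewrite !expg1 => /(modrelP se LL').
  have [||f [f_e f_D]] := low D D' (x' * l') DD'; first exact: subxx.
    by move=> m; apply: (modrel_cycle cG cG' se p_pr pG).
  exists f; split=> // m; have D'L' := csets_sub se LL' DD' DL.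
  have := subsetP D'L' _ (f_D m); rewrite -!(coset_eqE cG') => /eqP <-.
  rewrite (coset_eqE cG') expgMn; last exact: abelian_setT_mulC.
  by rewrite mulKg groupX.
have blkE := blk_srad cG cG' se p_pr pG aH naM.
have [b [b_gt0 bx DbE xE]] := cycle_subgroup Dx.
have b_gt1 : 1 < b.
  rewrite ltn_neqAle b_gt0 andbT; apply: contra x1 => /eqP b1.
  have : x \in blk x by apply: blk_refl.
  by rewrite blkE inE -DE DbE -b1 expg1 cycle_id.
have ab : aset <[x ^+ b]> by rewrite -DbE.
have [LD|LND] := boolP (L \subset D).
  have [||f [f_e f_L]] := step b b_gt1 bx ab L L' (x' ^+ b) LL'.
  - by rewrite -DbE.
  - by move=> m; rewrite -!expgM.
  apply: (lift_step cG cG' se LL' b_gt0 bx _ xx' f_e f_L) => y yx.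
  rewrite -DbE => yD; have yb : y \in blk x by rewrite blkE inE yx andbT.
  by rewrite (blk_eq se yb).
(* L meets the complement of D, which is the basic set of x, so L is all of [<[x]>] and the
   congruence modulo L' only asks that the map send [<[x]>] into L'. *)
have xL : x \in L.
  case/subsetPn: LND => l lL lD.
  have lx : l \in blk x by rewrite blkE inE (subsetP Lx) // andbT.
  by rewrite (subsetP (aset_subset_blk (csets_aset se LL') lL)) // (blk_sym se).
have LE : <[x]> = L by apply/eqP; rewrite eqEsubset cycle_subG xL.
(* Taking D for the subgroup and 1 for the element on the other side turns the congruence into the
   statement that [f] sends D into D'. *)
have [||f [f_e f_D]] := step b b_gt1 bx ab D D' 1 DD'.
- by rewrite -DbE.
- move=> m; rewrite expg1n; have xmD : (x ^+ b) ^+ m \in D by rewrite DbE mem_cycle.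
  by apply/exists_inP; exists ((x ^+ b) ^+ m)^-1; rewrite ?groupV // mulgV srel11.
have f_D' : {in D, forall g, f g \in D'}.
  move=> g; rewrite DbE => /cycleP[m ->].
  by have := f_D m; rewrite expg1n invg1 mul1g.
rewrite -DbE in f_e.
have HL' : csets <[x]> L' by rewrite LE.
have [f' [f'_e f'_L]] := lift_wreath cG cG' se DD' HL' b_gt0 bx DbE xE Dx blkE f_e f_D'.
exists f'; split=> // m; rewrite groupM ?f'_L ?mem_cycle // groupV.
by rewrite -(modrel_mem LL' (xx' m)) groupX.
Qed.

End Lifting.

(** * From algebraic isomorphisms to relations and back *)

Section AlgebraicIso.
Variables (gT gT' : finGroupType) (A : Sring gT) (A' : Sring gT').
Variable phi : basic_set A -> basic_set A'.
Hypothesis phi_iso : algebraic_iso phi.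

Lemma basic_set_ex (hT : finGroupType) (B : Sring hT) x :
  exists X : basic_set B, x \in val X.
Proof.
have /and3P[/eqP covB _ _] := basic_sets_partition B.
have : x \in cover (basic_sets B) by rewrite covB inE.
by case/bigcupP => X XB xX; exists (exist _ X XB).
Qed.

Lemma basic_set_eq (hT : finGroupType) (B : Sring hT) (X Y : basic_set B) x :
  x \in val X -> x \in val Y -> X = Y.
Proof.
move=> xX xY; apply: val_inj; have /and3P[_ /trivIsetP tiB _] := basic_sets_partition B.
apply: contraTeq xY => /(tiB _ _ (valP X) (valP Y)) /pred0P/(_ x)/=.
by rewrite xX /= => ->.
Qed.

Lemma basic_set_ne (hT : finGroupType) (B : Sring hT) (X : basic_set B) :
  exists x, x \in val X.
Proof.
apply/set0Pn; have /and3P[_ _] := basic_sets_partition B.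
by apply: contraNneq => <-; apply: valP.
Qed.

Lemma struct_constE (hT : finGroupType) (B : Sring hT) (X Y Z : basic_set B) z :
  z \in val Z -> struct_const Z X Y = (gsum (val X) * gsum (val Y))%R z.
Proof.
move=> zZ; rewrite /struct_const.
have /eqP XYd := xchooseP (struct_const_ex X Y).
by rewrite -(gsum_span_coef _ zZ) -XYd.
Qed.

Definition iso_rel (x : gT) (x' : gT') :=
  [exists X : {X : {set gT} | X \in basic_sets A}, (x \in val X) && (x' \in val (phi X))].

Lemma iso_relP x x' : reflect (exists2 X : basic_set A, x \in val X & x' \in val (phi X))
  (iso_rel x x').
Proof. exact: (iffP exists_inP). Qed.

Lemma iso_relE (X : basic_set A) x x' : x \in val X -> iso_rel x x' = (x' \in val (phi X)).
Proof.
move=> xX; apply/iso_relP/idP => [[Y xY]|]; last by exists X.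
by rewrite (basic_set_eq xX xY).
Qed.

Lemma iso_relEr (X : basic_set A) x x' : x' \in val (phi X) -> iso_rel x x' = (x \in val X).
Proof.
have [/bij_inj phi_inj _] := phi_iso.
move=> xX; apply/iso_relP/idP => [[Y xY x'Y]|]; last by exists X.
by rewrite (phi_inj _ _ (basic_set_eq xX x'Y)).
Qed.

Lemma gsum1 (hT : finGroupType) : gsum [set 1 : hT] = 1%R.
Proof. by apply/ffunP => g; rewrite !ffunE inE. Qed.

(** Let J be the preimage of {1}. Multiplying J by the identity gives structure constant 1; the same
    constant on the other side is the coefficient of 1 in the sum of phi {1}, so 1 lies in phi
    {1}. *)
Lemma iso_rel_one x x' : iso_rel x x' -> (x == 1) = (x' == 1).
Proof.
have [phi_bij phi_c] := phi_iso; have phi_inj := bij_inj phi_bij.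
pose I : basic_set A := exist _ [set 1] (basic_sets_one A).
pose I' : basic_set A' := exist _ [set 1] (basic_sets_one A').
have [psi phiK psiK] := phi_bij.
have [z zJ] := basic_set_ne (psi I').
have := phi_c (psi I') I (psi I'); rewrite psiK (struct_constE _ _ zJ).
have oneI' : 1 \in val I' by rewrite inE.
rewrite (struct_constE _ _ oneI') /= !gsum1 mulr1 mul1r !ffunE zJ.
case phiI : (1 \in val (phi I)) => // _.
have phiI' : phi I = I' := basic_set_eq phiI oneI'.
case/iso_relP => X xX x'X; apply/eqP/eqP => [x1|x'1].
  have oneI : x \in val I by rewrite x1 inE.
  by move: x'X; rewrite (basic_set_eq xX oneI) phiI' inE => /eqP.
have XI : X = I by apply: phi_inj; rewrite phiI'; apply: basic_set_eq x'X _; rewrite x'1.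
by move: xX; rewrite XI inE => /eqP.
Qed.

Lemma gsum_decomp (hT : finGroupType) (F : {X : {set gT} | X \in basic_sets A} -> {set hT})
    (h : basic_set A -> int) (a : group_ring hT) :
  (forall z, exists X, z \in F X) -> (forall X Y z, z \in F X -> z \in F Y -> X = Y) ->
  (forall X z, z \in F X -> a z = h X) -> a = (\sum_X gsum (F X) *~ h X)%R.
Proof.
move=> F_ex F_eq aE; apply/ffunP => z; have [X zX] := F_ex z.
rewrite sum_ffunE (bigD1 X) //= mulrz_ffunE ffunE zX intz big1 ?addr0 ?(aE X) // => Y YX.
rewrite mulrz_ffunE ffunE; case: (boolP (z \in F Y)) => [zY|_]; last by rewrite mul0rz.
by rewrite (F_eq _ _ _ zX zY) eqxx in YX.
Qed.

(** Compatible elements have equal coefficients on corresponding basic sets, so bilinearity reduces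
    the claim to equality of structure constants. *)
Lemma iso_rel_mul a b a' b' : schur_compat iso_rel a a' -> schur_compat iso_rel b b' ->
  schur_compat iso_rel (a * b)%R (a' * b')%R.
Proof.
have [phi_bij phi_c] := phi_iso; have phi_inj := bij_inj phi_bij.
have [psi phiK psiK] := phi_bij.
have decomp c c' : schur_compat iso_rel c c' -> exists h : basic_set A -> int,
    c = (\sum_X gsum (val X) *~ h X)%R /\ c' = (\sum_X gsum (val (phi X)) *~ h X)%R.
  move=> cc'; exists (fun X => c (repr (val X))).
  have hE (X : basic_set A) z' : z' \in val (phi X) -> c' z' = c (repr (val X)).
    move=> z'X; have [z zX] := basic_set_ne X.
    by apply/esym/cc'; rewrite (iso_relE _ (mem_repr z zX)).
  split.
    apply: gsum_decomp => [z | X Y z | X z zX]; first exact: basic_set_ex.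
      exact: basic_set_eq.
    have [z' z'X] := basic_set_ne (phi X).
    by rewrite -(hE X z' z'X); apply: cc'; rewrite (iso_relE _ zX).
  apply: gsum_decomp => [z' | X Y z' zX zY | X z'].
  - have [X' z'X] := basic_set_ex A' z'.
    by exists (psi X'); rewrite psiK.
  - exact: phi_inj (basic_set_eq zX zY).
  exact: hE.
case/decomp => h [-> ->] /decomp[k [-> ->]] z z' /iso_relP[Z zZ z'Z].
rewrite !mulr_suml !sum_ffunE; apply: eq_bigr => X _.
rewrite !mulr_sumr !sum_ffunE; apply: eq_bigr => Y _.
rewrite !mulrzAl !mulrzAr !mulrz_ffunE.
by rewrite -(struct_constE _ _ zZ) -(struct_constE _ _ z'Z) phi_c.
Qed.

Lemma schur_rel_iso : schur_rel iso_rel.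
Proof.
have [[psi phiK psiK] _] := phi_iso.
split=> [x | x' | x y x' y' | x x' | a b a' b'].
- have [X xX] := basic_set_ex A x; have [x' x'X] := basic_set_ne (phi X).
  by exists x'; rewrite (iso_relE _ xX).
- have [X' x'X'] := basic_set_ex A' x'; have [x xX] := basic_set_ne (psi X').
  by exists x; rewrite (iso_relE _ xX) psiK.
- case/iso_relP => X xX x'X; rewrite (iso_relEr _ x'X) => yX.
  by rewrite (iso_relE _ yX) (iso_relE _ xX).
- exact: iso_rel_one.
exact: iso_rel_mul.
Qed.

Lemma induced_by_iso (f : gT -> gT') : bijective f ->
  (forall g h, iso_rel (g * h^-1) (f g * (f h)^-1)) -> induced_by phi f.
Proof.
case=> f' fK f'K f_iso X; apply/setP => -[u v]; apply/imsetP/imset2P.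
  case=> _ /imset2P[x g xX _ ->] /= [-> ->].
  apply: (Imset2spec (x1 := f (x * g) * (f g)^-1) (x2 := f g)).
  - by rewrite -(iso_relE _ xX); have := f_iso (x * g) g; rewrite mulgK.
  - by rewrite inE.
  by rewrite mulgKV.
case=> x' u' x'X _ [-> ->]; exists (f' u', f' (x' * u')); last by rewrite /= !f'K.
apply/imset2P; apply: (Imset2spec (x1 := f' (x' * u') * (f' u')^-1) (x2 := f' u')).
- by rewrite -(iso_relEr _ x'X); have := f_iso (f' (x' * u')) (f' u'); rewrite !f'K mulgK.
- by rewrite inE.
by rewrite mulgKV.
Qed.

Lemma induced_by_combinatorial_iso (f : gT -> gT') : bijective f ->
  induced_by phi f -> combinatorial_iso A A' f.
Proof.
have [[psi phiK psiK] _] := phi_iso.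
move=> f_bij ind; split=> //; apply/setP => E; apply/imsetP/imsetP => -[X XA ->].
  by exists (val (phi (exist _ X XA))); [apply: valP | rewrite -ind].
exists (val (psi (exist _ X XA))); first exact: valP.
by rewrite ind psiK.
Qed.

End AlgebraicIso.

Theorem theorem1p1 (p : nat) (hp : prime p) (gT : finGroupType)
    (hcyc : cyclic [set: gT]) (hpG : (p.-group [set: gT])%g) :
  separable_group abelian_group gT.
Proof.
move=> A gT' A' phi cG' phi_iso.
have se := schur_rel_iso phi_iso; have cG := cyclic_abelian hcyc.
have /cyclicP[x xT] := hcyc.
have aT : schur_aset (iso_rel phi) <[x]> by rewrite -xT; apply/asetP => *; rewrite inE.
(* With L and L' the whole groups there is nothing to lift: the quotients are trivial, and 1 serves
   as x'. *)
have [|||f [f_e _]] := @schur_rel_lift _ _ _ cG cG' se p hp hpG x [group of setT] [group of setT] 1 aT.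
- by move=> y y' _; rewrite !inE.
- by rewrite -xT.
- move=> m; have [y ey] := srel_surj se (1 ^+ m).
  by apply/exists_inP; exists ((x ^+ m)^-1 * y); rewrite ?inE ?mulKVg.
have f_iso g h : iso_rel phi (g * h^-1) (f g * (f h)^-1) by apply: f_e; rewrite -xT inE.
have f_bij : bijective f.
  apply: inj_card_bij => [g h fgh|]; last by rewrite (card_srel se).
  apply/eqP; rewrite eq_mulgV1 (srel_one se (f_iso g h)) fgh mulgV //.
have ind := induced_by_iso phi_iso f_bij f_iso.
exists f; split=> //. exact: (induced_by_combinatorial_iso phi_iso f_bij ind).
Qed.
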